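(* Let $B$ be a symmetric bilinear form over $\mathbb{Z}$ (on a finitely generated free $\mathbb{Z}$-module $V$) with determinant $\pm1$, and let $\psi\colon T\to\mathbb{Q}/\mathbb{Z}$ be a tame quadratic function on a finite abelian group $T$. Then $$\beta(B\otimes\psi)=\sigma(B)\cdot\beta(\psi)\in\mathbb{Q}/\mathbb{Z},$$ where $\sigma(B)$ is the signature of $B$.
   Context: A function $\psi\colon T\to\mathbb{Q}/\mathbb{Z}$ on a finite abelian group is quadratic if $\psi(ax)=a^2\psi(x)$ for all $a\in\mathbb{Z}$, $x\in T$, and $b(x,y)=\psi(x+y)-\psi(x)-\psi(y)$ is bilinear. $T^\perp=\{t\in T: b(t,s)=0\ \forall s\in T\}$; $\psi$ is tame if $\psi|_{T^\perp}=0$. The Gauss sum is $G(\psi)=\sum_{t\in T}e^{2\pi i\psi(t)}$, and when $G(\psi)\neq0$ (equivalently, $\psi$ is tame) the phase $\beta(\psi)$ is defined by $G(\psi)=|G(\psi)|\,e^{2\pi i\beta(\psi)}$. For a symmetric bilinear form $B\colon V\times V\to\mathbb{Z}$, the function $B\otimes\psi\colon V\otimes T\to\mathbb{Q}/\mathbb{Z}$ is the quadratic function with $(B\otimes\psi)(v\otimes x)=B(v,v)\psi(x)$ and associated bilinear form $B\otimes b$; explicitly, for a basis $e_1,\dots,e_n$ of $V$, $(B\otimes\psi)(\sum_i e_i\otimes t_i)=\sum_i B(e_i,e_i)\psi(t_i)+\sum_{i<j}B(e_i,e_j)b(t_i,t_j)$. *)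

(* Defs.v *)
From HB Require Import structures.
From mathcomp Require Import all_boot all_order all_algebra generic_quotient.
From mathcomp Require Import boolp classical_sets reals trigo.
From mathcomp Require Import complex.

Set Implicit Arguments.
Unset Strict Implicit.
Unset Printing Implicit Defensive.

Import Order.TTheory GRing.Theory Num.Theory.

Local Open Scope ring_scope.
Local Open Scope quotient_scope.
Local Open Scope complex_scope.

(* Num.int_num_subdef is the predicate underlying Num.int; it is the one that *)
(* carries the closure instances needed to form the quotient group.           *)
Definition QZ : zmodType :=
  {ideal_quot (GRing.ZmodClosed.clone rat (@Num.int_num_subdef rat) _)}.

(* q |-> e^(2 pi i q); independence of the representative is expQZ_pi below.  *)
Definition expQZ (R : realType) (q : QZ) : R[i] :=
  let x : R := 2 * pi * ratr (repr q) in cos x +i* sin x.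

Definition biadditive (U U' W : zmodType) (f : U -> U' -> W) : Prop :=
  (forall y, {morph f^~ y : x x' / x + x'}) /\
  (forall x, {morph f x : y y' / y + y'}).

Section Quadratic.
Variable T : zmodType.

Definition polar (psi : T -> QZ) (x y : T) : QZ := psi (x + y) - psi x - psi y.

Definition quadratic (psi : T -> QZ) : Prop :=
  (forall (a : int) (x : T), psi (x *~ a) = psi x *~ (a ^+ 2)) /\
  biadditive (polar psi).

Definition tame (psi : T -> QZ) : Prop :=
  forall t : T, (forall s : T, polar psi t s = 0) -> psi t = 0.

End Quadratic.

Definition gauss_sum (R : realType) (T : finZmodType) (psi : T -> QZ) : R[i] :=
  \sum_(t : T) expQZ R (psi t).

(* For a nonzero Gauss sum the phase is unique, by expQZ_inj below; the       *)
(* default value 0 is only meant for psi with vanishing Gauss sum.            *)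
Definition phase (R : realType) (T : finZmodType) (psi : T -> QZ) : QZ :=
  xget 0 [set b : QZ | gauss_sum R psi != 0 /\
                       gauss_sum R psi = `|gauss_sum R psi| * expQZ R b].

Section Forms.
Variables (V : lmodType int) (n : nat) (e : 'I_n -> V) (B : {biscalar V}).

Definition is_basis : Prop :=
  bijective (fun c : 'rV[int]_n => \sum_i c 0 i *: e i).

Definition gram : 'M[int]_n := \matrix_(i, j) B (e i) (e j).

(* The basis e identifies V (x) T with T^n: the row vector t stands for       *)
(* \sum_i e_i (x) t_i.                                                        *)
Definition form_tensor (T : zmodType) (psi : T -> QZ) (t : 'rV[T]_n) : QZ :=
  \sum_(i < n) psi (t 0 i) *~ B (e i) (e i) +
  \sum_(i < n) \sum_(j < n | (i < j)%N) polar psi (t 0 i) (t 0 j) *~ B (e i) (e j).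

End Forms.

(* Number of positive minus number of negative entries of a diagonal matrix   *)
(* congruent to M; by Sylvester's law of inertia the choice is irrelevant.    *)
Definition signature (R : realType) (n : nat) (M : 'M[R]_n) : int :=
  xget 0 [set s : int | exists (P : 'M[R]_n) (d : 'rV[R]_n),
    [/\ P \in unitmx, P *m M *m P^T = diag_mx d &
        s = #|[set i | 0 < d 0 i]|%:Z - #|[set i | d 0 i < 0]|%:Z]].

Lemma expQZ_pi (R : realType) (q : rat) :
  expQZ R (\pi_QZ q) = cos (2 * pi * ratr q) +i* sin (2 * pi * ratr q).
Proof.
have /intrP[m Em] : repr (\pi_QZ q) - q \is a Num.int.
  set I := GRing.ZmodClosed.clone rat (@Num.int_num_subdef rat) _.
  by rewrite -[_ \is a _]/(_ \in I) Quotient.idealrBE reprK.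
have per k (x : R) : cos (x + 2 * pi * k%:~R) = cos x /\
                     sin (x + 2 * pi * k%:~R) = sin x.
  have pos j y : cos (y + 2 * pi * j%:R) = cos y :> R /\
                 sin (y + 2 * pi * j%:R) = sin y :> R.
    rewrite mulr_natr [2 * pi]mulrC mulr_natr.
    by rewrite (periodicn (@cosD2pi R)) (periodicn (@sinD2pi R)).
  case: k => j; first exact: pos.
  have [<- <-] := pos j.+1 (x + 2 * pi * (Negz j)%:~R).
  by rewrite NegzE mulrNz mulrN -pmulrn subrK.
rewrite /expQZ -[repr _](subrK q) Em addrC rmorphD /= ratr_int mulrDr.
by have [-> ->] := per m (2 * pi * ratr q).
Qed.

Lemma expQZD (R : realType) : {morph expQZ R : x y / x + y >-> x * y}.
Proof.
move=> x y; rewrite -[x]reprK -[y]reprK.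
rewrite -[\pi_QZ _ + _](Quotient.pi_add _ (repr x) (repr y)) !expQZ_pi.
rewrite rmorphD /= mulrDr cosD sinD; apply/eqP; rewrite eq_complex /= eqxx /=.
by rewrite addrC.
Qed.

Lemma expQZ_inj (R : realType) : injective (expQZ R).
Proof.
move=> x y exy; apply/eqP; rewrite -subr_eq0; apply/eqP.
have: expQZ R (x - y) = 1.
  have e0 : expQZ R 0 = 1.
    have -> : 0 = \pi_QZ 0 by rewrite piE.
    by rewrite expQZ_pi rmorph0 mulr0 cos0 sin0.
  by rewrite expQZD exy -expQZD subrr.
set q := repr (x - y); set r := q - (Num.floor q)%:~R => e1.
have Eq : x - y = \pi_QZ r.
  rewrite -[x - y]reprK -/q; apply/eqP; rewrite -Quotient.idealrBE /r subKr.
  exact: intr_int.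
move: e1; rewrite Eq expQZ_pi => -[+ _].
have /andP[r0 r1] : 0 <= r < 1.
  by rewrite /r subr_ge0 ltrBlDl -[X in _ < _ + X]/(1%:~R) -intrD floor_itv.
have -> : 2 * pi * ratr r = (pi * ratr r) *+ 2 :> R by rewrite -mulrA mulr_natl.
move: r0; rewrite le_eqVlt => /predU1P[<- _|r0]; first by rewrite piE.
have : 0 < sin (pi * ratr r : R).
  rewrite sin_gt0_pi// mulr_gt0 ?pi_gt0 ?ltr0q//=.
  by rewrite gtr_pMr ?pi_gt0// -(rmorph1 (@ratr R)) ltr_rat.
rewrite cos_mulr2n => s0 /eqP.
rewrite subr_eq -[1 + 1]/(1 *+ 2) eqrMn2r /= => /eqP c1.
have /eqP := cos2Dsin2 (pi * ratr r : R).
by rewrite c1 -subr_eq0 addrC addKr expf_eq0 (gt_eqF s0).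
Qed.

(* Main.v *)
(** Pulling psi back along Z^T -> T presents it as x C x^T / N with C an integral matrix, and B (x) psi
as the form B (x) C / N on (Z/N)^n (x) (Z/N)^m.  By the Chinese remainder theorem N may be taken to be a
prime power p^k.

If p is odd, B is diagonal over Z_(p) with unit entries d_i.  The one-dimensional sums g(u) satisfy
g(u) g(v) = g(1) g(uv) up to a positive factor, so the product of the g(d_i) depends only on n and on
det B = 1 or -1 modulo squares, hence equals the product of the g(sign d_i); and g(-1) is the conjugate
of g(1).

If p = 2, coordinates in the radical are removed by tameness until 2^(k-1) C^-1 = G/N' with N' odd and G
integral.  Milgram's formula for the even lattice B^-1 (x) N' G then expresses the sum modulo 2^k through
e^(2 pi i sign(B) sign(G)/8) and a sum of odd modulus.  Milgram's formula reduces to a diagonal sublattice,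
that is to the phase of the sums of e^(2 pi i w^2/4a) over w mod 2a, which is found from
gaussian (a k^2) = k gaussian a by comparing a k^2 with a nearby square. *)

From HB Require Import structures.
Require Import Defs.
From mathcomp Require Import all_boot all_order perm all_algebra generic_quotient.
From mathcomp Require Import boolp classical_sets reals topology normedtype trigo derive.
From mathcomp Require Import complex.
From mathcomp Require Import ring lra zify.

Set Implicit Arguments.
Unset Strict Implicit.
Unset Printing Implicit Defensive.

Import Order.TTheory GRing.Theory Num.Theory.
Import numFieldNormedType.Exports.

Local Open Scope quotient_scope.
Local Open Scope ring_scope.
Local Open Scope complex_scope.

(** The phase of psi itself is never evaluated. What is shown is that a single b in Q/Z serves every
    unimodular B at once, the sum for B having phase sigma(B) b; the identity form of rank one then
    identifies b with beta(psi).

    The obstacle is the prime 2: a unimodular form over Z_(2) need not be diagonalizable, as even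
    forms show, so the reduction to one-dimensional sums breaks down. Over Q diagonalization is
    always possible, and Milgram's formula sees nothing but signatures; hence the sum modulo a power
    of 2 is placed inside the Gauss sum of an integral lattice. The price is an extra odd modulus,
    which the odd case accounts for.

    That odd modulus has to be the square N'^2. The Chinese remainder theorem multiplies C by the
    complementary modulus: the factor N'^2 is absorbed by the substitution V -> N' V, whereas a
    factor N' could change the phase modulo 2^k. *)

Section Exponential.
Variable R : realType.

Definition E (q : rat) : R[i] := cos (2 * pi * ratr q) +i* sin (2 * pi * ratr q).

Lemma E_expQZ (q : rat) : expQZ R (\pi_QZ q) = E q.
Proof. exact: expQZ_pi. Qed.

Lemma expQZ_repr (x : QZ) : expQZ R x = E (repr x).
Proof. by rewrite -E_expQZ reprK. Qed.

Lemma ED q r : E (q + r) = E q * E r.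
Proof.
rewrite /E rmorphD mulrDr cosD sinD; apply/eqP; rewrite eq_complex /= eqxx /=.
by rewrite addrC.
Qed.

Lemma E0 : E 0 = 1.
Proof. by rewrite /E rmorph0 mulr0 cos0 sin0. Qed.

Lemma E_int (q : rat) : q \is a Num.int -> E q = 1.
Proof.
move=> q_int; rewrite -E_expQZ.
suff -> : \pi_QZ q = \pi_QZ 0 by rewrite E_expQZ E0.
by apply/eqP; rewrite -Quotient.idealrBE subr0.
Qed.

Lemma E_sum (I : Type) (s : seq I) (P : pred I) (F : I -> rat) :
  E (\sum_(i <- s | P i) F i) = \prod_(i <- s | P i) E (F i).
Proof. exact: (big_morph E ED E0). Qed.

Lemma EN q : E (- q) = ((E q)^*)%R.
Proof. by rewrite /E rmorphN mulrN cosN sinN. Qed.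

Lemma EX q k : E (q *+ k) = E q ^+ k.
Proof. by elim: k => [|k IH]; rewrite ?E0 // mulrS exprS ED IH. Qed.

Lemma ENK q : E q * E (- q) = 1.
Proof. by rewrite -ED subrr E0. Qed.

Lemma normE q : `|E q| = 1.
Proof. by apply/eqP; rewrite -sqrp_eq1 // normCK -EN ENK. Qed.

Lemma E_neq0 q : E q != 0.
Proof. by rewrite -normr_eq0 normE oner_eq0. Qed.

Lemma ENV q : E (- q) = (E q)^-1.
Proof. by apply: (mulfI (E_neq0 q)); rewrite ENK mulfV // E_neq0. Qed.

Lemma E_eq (q r : rat) : q - r \is a Num.int -> E q = E r.
Proof. by move=> qr; rewrite -[q](subrK r) ED (E_int qr) mul1r. Qed.

Lemma expQZ0 : expQZ R 0 = 1.
Proof. by have /(_ 0) := E_expQZ; rewrite piE E0. Qed.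

Lemma expQZ_neq0 x : expQZ R x != 0.
Proof. by rewrite expQZ_repr E_neq0. Qed.

Lemma expQZN x : expQZ R (- x) = (expQZ R x)^-1.
Proof.
by apply: (mulfI (expQZ_neq0 x)); rewrite mulfV ?expQZ_neq0 // -expQZD subrr expQZ0.
Qed.

Lemma expQZMn x k : expQZ R (x *+ k) = expQZ R x ^+ k.
Proof. by elim: k => [|k IH]; rewrite ?expQZ0 // mulrS exprS expQZD IH. Qed.

Lemma expQZMz x (k : int) : expQZ R (x *~ k) = expQZ R x ^ k.
Proof. by case: k => k; rewrite /= -?pmulrn ?expQZMn // NegzE mulrNz expQZN expQZMn. Qed.

Lemma E_eq1 (q : rat) : E q = 1 -> q \is a Num.int.
Proof.
rewrite -E_expQZ -expQZ0 => /expQZ_inj; rewrite -(reprK 0) => /eqP.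
rewrite -Quotient.idealrBE => h; suff r0 : repr (0 : QZ) \is a Num.int.
  by rewrite -[q](subrK (repr (0 : QZ))) rpredD.
have : (\pi_QZ (repr (0 : QZ))) == \pi_QZ 0 by rewrite reprK piE.
by rewrite -Quotient.idealrBE subr0.
Qed.

(* Equality of phases: every Gauss sum below is only computed up to a positive factor. *)
Definition ray (z w : R[i]) := exists2 r : R[i], 0 < r & z = r * w.

Lemma ray_refl z : ray z z.
Proof. by exists 1; rewrite ?ltr01 ?mul1r. Qed.

Lemma ray_eq z w : z = w -> ray z w.
Proof. by move=> ->; apply: ray_refl. Qed.

Lemma ray_sym z w : ray z w -> ray w z.
Proof.
by move=> [r r0 ->]; exists r^-1; rewrite ?invr_gt0 // mulKf // gt_eqF.
Qed.

Lemma ray_trans w z t : ray z w -> ray w t -> ray z t.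
Proof.
by move=> [r r0 ->] [s s0 ->]; exists (r * s); rewrite ?mulr_gt0 ?mulrA.
Qed.

Lemma ray_scale r z : 0 < r -> ray (r * z) z.
Proof. by move=> r0; exists r. Qed.

Lemma rayM z w z' w' : ray z w -> ray z' w' -> ray (z * z') (w * w').
Proof.
by move=> [r r0 ->] [s s0 ->]; exists (r * s); rewrite ?mulr_gt0 // mulrACA.
Qed.

Lemma ray_prod (I : Type) (s : seq I) (P : pred I) (F G : I -> R[i]) :
  (forall i, P i -> ray (F i) (G i)) ->
  ray (\prod_(i <- s | P i) F i) (\prod_(i <- s | P i) G i).
Proof. by move=> FG; apply: big_ind2 => //; [exact: ray_refl | move=> *; exact: rayM]. Qed.

Lemma ray_neq0 z w : ray z w -> w != 0 -> z != 0.
Proof. by move=> [r r0 ->] w0; rewrite mulf_neq0 // gt_eqF. Qed.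

Lemma ray_conj z w : ray z w -> ray (z^*)%R (w^*)%R.
Proof.
move=> [r r0 ->]; exists r => //; rewrite rmorphM; congr (_ * _).
by apply/CrealP/ger0_real/ltW.
Qed.

Lemma ray_cancel z w w' : w' != 0 -> ray (z * w') (w * w') -> ray z w.
Proof. by move=> w0 [r r0]; rewrite mulrA => /(mulIf w0) ->; exists r. Qed.

Lemma ray_norm z w : `|w| = 1 -> ray z w -> z = `|z| * w.
Proof. by move=> w1 [r r0 ->]; rewrite normrM w1 mulr1 gtr0_norm. Qed.

Lemma ray_self z : z != 0 -> ray z (z / `|z|).
Proof. by move=> z0; exists `|z|; rewrite ?normr_gt0 // mulrC divfK // normr_eq0. Qed.

End Exponential.

(** * Real-valued moduli and bounds for e^(2 pi i q) - 1 *)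

Section ComplexModulus.
Variable R : realType.

(** The norm of [R[i]] takes its values in [R[i]]; passing to the real part lets all estimates take
    place in the ordered field [R]. *)
Definition modulus (z : R[i]) : R := complex.Re `|z|.

Lemma modulusE z : `|z| = (modulus z)%:C.
Proof. by rewrite /modulus RRe_real // normr_real. Qed.

Lemma modulusD z w : modulus (z + w) <= modulus z + modulus w.
Proof. by have := ler_normD z w; rewrite !modulusE -rmorphD lecR. Qed.

Lemma modulusM z w : modulus (z * w) = modulus z * modulus w.
Proof. by apply: complexI; rewrite rmorphM -!modulusE normrM. Qed.

Lemma modulusN z : modulus (- z) = modulus z.
Proof. by rewrite /modulus normrN. Qed.

Lemma modulus_ge0 z : 0 <= modulus z.
Proof. by have := normr_ge0 z; rewrite modulusE lecR. Qed.

Lemma modulus0 : modulus 0 = 0.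
Proof. by rewrite /modulus normr0. Qed.

Lemma modulus_real (r : R) : 0 <= r -> modulus r%:C = r.
Proof. by move=> r0; rewrite /modulus ger0_norm ?lecR. Qed.

Lemma modulus_sum (I : Type) (s : seq I) (P : pred I) (F : I -> R[i]) :
  modulus (\sum_(i <- s | P i) F i) <= \sum_(i <- s | P i) modulus (F i).
Proof.
by apply: (big_ind2 (fun z r => modulus z <= r)) => [|z r w t zr wt|i _];
  rewrite ?modulus0 // (le_trans (modulusD _ _)) // lerD.
Qed.

Lemma modulusE1 q : modulus (E R q) = 1.
Proof. by rewrite /modulus normE. Qed.

Lemma sin_le_norm (x : R) : `|sin x| <= `|x|.
Proof.
wlog x0 : x / 0 <= x.
  by move=> h; case: (leP 0 x) => [/h //|/ltW]; rewrite -oppr_ge0 => /h; rewrite sinN !normrN.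
have [c _] : exists2 c, c \in `[0, x] & sin x - sin 0 = cos c * (x - 0).
  apply: (@MVT_segment _ (@sin R) cos) => //.
  by apply: continuous_subspaceT => y; exact: continuous_sin.
rewrite sin0 !subr0 => ->.
by rewrite normrM ler_piMl // cos_max.
Qed.

Lemma modulus_E_sub1 q : modulus (E R q - 1) ^+ 2 = (sin (pi * ratr q)) ^+ 2 * 4.
Proof.
apply: complexI; rewrite rmorphXn /= -modulusE normCK.
have -> : E R q - 1 = (cos (2 * pi * ratr q) - 1) +i* sin (2 * pi * ratr q).
  by rewrite /E; simpc.
have -> : 2 * pi * ratr q = (pi * ratr q) *+ 2 :> R by rewrite -mulrA mulr_natl.
rewrite sin_mulr2n cos_mulr2n; simpc.
apply/eqP; rewrite eq_complex /=; apply/andP; split; apply/eqP; last ring.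
set s := sin _; set c := cos _.
have h : c ^+ 2 = 1 - s ^+ 2 by rewrite cos2sin2.
ring: h.
Qed.

(** From |E q - 1| = 2 |sin (pi q)|; the crude bound pi <= 4 turns 2 pi into 8. *)
Lemma modulus_E_sub1_le q : modulus (E R q - 1) <= 8 * `|ratr q|.
Proof.
rewrite -(ler_pXn2r (isT : (0 < 2)%N)) ?nnegrE ?modulus_ge0 ?mulr_ge0 //.
rewrite modulus_E_sub1 -[_ ^+ 2]real_normK ?num_real //.
have h := sin_le_norm (pi * ratr q).
have pi4 : pi <= 4 :> R by have := @pihalf_lt2 R; lra.
have h' : `|pi * ratr q| <= 4 * `|ratr q| :> R.
  by rewrite normrM ger0_norm ?pi_ge0 // ler_wpM2r.
have := le_trans h h'; have := normr_ge0 (sin (pi * ratr q) : R).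
set s := `|sin _|; set t := `|ratr q|; nra.
Qed.

End ComplexModulus.

(** * Quadratic Gauss sums in one variable *)

Section QuadraticChirp.
Variable R : realType.
Local Notation E := (E R).

Lemma modulus_E_sub1_ge (q : rat) : 0 <= q <= 1 / 2 -> 2 * ratr q <= modulus (E q - 1).
Proof.
(* Here cos (2 pi p) <= 0, so |E p - 1|^2 >= 2, while 2 p <= 1. *)
have far p : 1 / 4 <= p <= 1 / 2 -> 2 * ratr p <= modulus (E p - 1).
  move=> /andP[p4 p2].
  have [r4 r2] : 1 / 4 <= ratr p :> R /\ ratr p <= 1 / 2 :> R.
    have := p4; have := p2; rewrite -!(ler_rat R). rewrite !fmorph_div. rewrite !rmorph1 !rmorph_nat.
    by split.
  have pi0 := @pi_gt0 R.
  have h4 : pi * (1 / 4) <= pi * ratr p :> R by rewrite ler_pM2l.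
  have h2 : pi * ratr p <= pi * (1 / 2) :> R by rewrite ler_pM2l.
  have c0 : cos (2 * pi * ratr p) <= 0 :> R.
    rewrite -(@cos_pihalf R) leNgt ltr_cos ?in_itv /= -?leNgt.
    - by lra.
    - by apply/andP; split; lra.
    - by apply/andP; split; lra.
  have := modulus_E_sub1 R p; have := modulus_ge0 (E p - 1).
  move: c0; have -> : 2 * pi * ratr p = (pi * ratr p) *+ 2 :> R by rewrite -mulrA mulr_natl.
  rewrite cos_mulr2n => c0; rewrite sin2cos2.
  set m := modulus _; set c := cos _ in c0 *; set t := ratr p in r4 r2 *.
  rewrite -mulr_natr in c0.
  by nra.
(* f q = |E q - 1| satisfies f (2 q) <= 2 f q, which propagates the bound from [1/4, 1/2] to 0. *)
have dbl p : modulus (E (p *+ 2) - 1) <= 2 * modulus (E p - 1).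
  have -> : E (p *+ 2) - 1 = (E p + 1) * (E p - 1) by rewrite EX; ring.
  rewrite modulusM ler_wpM2r ?modulus_ge0 //.
  apply: le_trans (modulusD _ _) _; rewrite modulusE1.
  by rewrite -[X in modulus X](E0 R) modulusE1; lra.
rewrite le_eqVlt => /andP[/predU1P[<- _|q0 q2]].
  by rewrite rmorph0 mulr0 modulus_ge0.
suff near n p : 1 / 4 <= p * 2 ^+ n -> 0 < p <= 1 / 2 -> 2 * ratr p <= modulus (E p - 1).
  apply: (near (Num.bound q^-1)); last by rewrite q0.
  have := upper_nthrootP (leqnn (Num.bound q^-1)).
  rewrite -[X in X < _]mul1r ltr_pdivrMr // mulrC => /ltW h.
  by apply: le_trans h; lra.
elim: n p => [|n IH] p; first by rewrite expr0 mulr1 => p4 /andP[_ p2]; apply/far/andP.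
case: (leP (1 / 4) p) => [p4 _ /andP[_ p2]|p4]; first by apply/far/andP.
rewrite exprS mulrA mulr_natr => /(IH (p *+ 2)) {}IH /andP[p0 _].
have := le_trans (IH _) (dbl p); rewrite rmorphMn /= -[ratr p *+ 2]mulr_natl.
by rewrite ler_pM2l // ; apply; apply/andP; split; lra.
Qed.

(** The denominator 4 a is the one met for an even lattice: w^2 / (2 b c) with c = 2 h is w^2 / (4 b
    h). *)
Definition chirp (a w : nat) : R[i] := E (w%:R ^+ 2 / (4 * a%:R)).

Lemma ratr_chirp (a w : nat) : ratr (w%:R ^+ 2 / (4 * a%:R)) = w%:R ^+ 2 / (4 * a%:R) :> R.
Proof. by rewrite fmorph_div rmorphXn rmorphM !rmorph_nat. Qed.

Section Tail.
Variable a : nat.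

Let step (w : nat) : rat := (2 * w%:R + 1) / (4 * a%:R).
Let c (w : nat) : R[i] := (E (step w) - 1)^-1.

Let ratr_step w : ratr (step w) = (2 * w%:R + 1) / (4 * a%:R) :> R.
Proof. by rewrite fmorph_div rmorphD !rmorphM rmorph1 !rmorph_nat. Qed.

Let chirpS w : (0 < a)%N -> chirp a w.+1 = chirp a w * E (step w).
Proof.
move=> a0; rewrite /chirp -ED; congr (E _).
have a0' : a%:R != 0 :> rat by rewrite pnatr_eq0 -lt0n.
by rewrite /step -natr1; field.
Qed.

(** The restriction w < a keeps the phase increment below 1/2, the range of [modulus_E_sub1_ge];
    this is why a full period 2 a is later folded onto [0, a]. *)
Let step_ge w : (w < a)%N -> (2 * w%:R + 1) / (2 * a%:R) <= modulus (E (step w) - 1).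
Proof.
move=> wa; have a0 : 0 < a%:R :> rat by rewrite ltr0n (leq_ltn_trans _ wa).
have a0' : 0 < a%:R :> R by rewrite ltr0n (leq_ltn_trans _ wa).
apply: le_trans (modulus_E_sub1_ge _); last first.
  apply/andP; split; first by rewrite /step divr_ge0 ?addr_ge0 ?mulr_ge0 ?ler0n.
  rewrite /step ler_pdivrMr ?mulr_gt0 //.
  have : (w.+1)%:R <= a%:R :> rat by rewrite ler_nat.
  by rewrite -natr1; lra.
rewrite ratr_step; have -> : 2 * ((2 * w%:R + 1) / (4 * a%:R)) = (2 * w%:R + 1) / (2 * a%:R) :> R.
  by field; rewrite gt_eqF.
by [].
Qed.

Let step_neq0 w : (w < a)%N -> E (step w) - 1 != 0.
Proof.
move=> wa; apply/eqP => h; have := step_ge wa; rewrite h modulus0 leNgt.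
by rewrite divr_gt0 ?mulr_gt0 ?ltr0n ?(leq_ltn_trans _ wa) // ltr_wpDl ?mulr_ge0.
Qed.

Let c_le w : (0 < w < a)%N -> modulus (c w) <= a%:R / w%:R.
Proof.
move=> /andP[w0 wa]; have := step_ge wa; have z0 := step_neq0 wa.
have : modulus (E (step w) - 1) * modulus (c w) = 1.
  by rewrite -modulusM mulfV // -(E0 R) modulusE1.
have a0 : 0 < a%:R :> R by rewrite ltr0n (leq_ltn_trans _ wa).
have w0' : 0 < w%:R :> R by rewrite ltr0n.
rewrite ler_pdivlMr // ler_pdivrMr ?mulr_gt0 //; move: (modulus _) (modulus _) => c' m h1 h2.
have m0 : 0 < m by nra.
have c0 : 0 < c' by nra.
have : (2 * w%:R + 1) * c' <= m * (2 * a%:R) * c' by rewrite ler_wpM2r // ltW.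
have -> : m * (2 * a%:R) * c' = (m * c') * (2 * a%:R) by ring.
by rewrite h1 mul1r; nra.
Qed.

(** Consecutive increments differ by the constant 1 / (2 a), which contributes 4 / a, and [c_le]
    bounds the two denominators. The result 4 a / (w (w + 1)) is written as a difference of
    reciprocals so that it telescopes in [abel]. *)
Let c_diff w : (0 < w)%N -> (w.+1 < a)%N -> 
  modulus (c w.+1 - c w) <= 4 * a%:R * (w%:R^-1 - (w.+1)%:R^-1).
Proof.
move=> w0 wa; have wa' := ltnW wa.
have z0 := step_neq0 wa'; have z1 := step_neq0 wa.
have a0 : 0 < a%:R :> R by rewrite ltr0n (leq_ltn_trans _ wa).
have a0' : 0 < a%:R :> rat by rewrite ltr0n (leq_ltn_trans _ wa).
have -> : c w.+1 - c w = - (E (1 / (2 * a%:R)) - 1) * E (step w) * (c w * c w.+1).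
  have e : E (step w.+1) = E (1 / (2 * a%:R)) * E (step w).
    by rewrite -ED /step -natr1; congr (E _); field; rewrite gt_eqF.
  by rewrite e in z1 *; rewrite /c e; field; rewrite z0 z1.
rewrite !modulusM modulusN modulusE1 mulr1.
have h0 := c_le (introT andP (conj w0 wa')).
have h1 := c_le (introT andP (conj (isT : (0 < w.+1)%N) wa)).
have h2 : modulus (E (1 / (2 * a%:R)) - 1) <= 4 / a%:R.
  apply: le_trans (modulus_E_sub1_le _ _) _.
  rewrite fmorph_div rmorphM rmorph1 !rmorph_nat ger0_norm ?divr_ge0 ?mulr_ge0 ?ler0n //.
  by rewrite le_eqVlt; apply/orP; left; apply/eqP; field; rewrite gt_eqF.
apply: le_trans (ler_pM (modulus_ge0 _) (mulr_ge0 (modulus_ge0 _) (modulus_ge0 _)) h2 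
  (ler_pM (modulus_ge0 _) (modulus_ge0 _) h0 h1)) _.
rewrite le_eqVlt; apply/orP; left; apply/eqP; rewrite -natr1; field.
by rewrite addrC natr1 !pnatr_eq0 -!lt0n w0 (leq_trans _ wa).
Qed.

(* Abel summation, using chirp a w = c w * (chirp a w.+1 - chirp a w). *)
Let abel X Y : (0 < X <= Y)%N -> (Y < a)%N ->
  modulus (\sum_(X <= w < Y) chirp a w - (c Y * chirp a Y - c X * chirp a X))
  <= 4 * a%:R * (X%:R^-1 - Y%:R^-1).
Proof.
move=> /andP[X0]; elim: Y => [|Y IH]; first by rewrite leqn0 => /eqP E0; rewrite E0 in X0.
rewrite leq_eqVlt => /predU1P[<- _|].
  by rewrite big_geq // !subrr modulus0 mulr0.
rewrite ltnS => XY Ya; have Ya' := ltnW Ya.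
have z0 := step_neq0 Ya'.
have -> : \sum_(X <= w < Y.+1) chirp a w - (c Y.+1 * chirp a Y.+1 - c X * chirp a X) =
  (\sum_(X <= w < Y) chirp a w - (c Y * chirp a Y - c X * chirp a X))
   - (c Y.+1 - c Y) * chirp a Y.+1.
  rewrite big_nat_recr //= chirpS ?(leq_ltn_trans _ Ya) //.
  have cY : c Y * (E (step Y) - 1) = 1 by rewrite mulVf.
  by rewrite -[X in _ + X - _](mulr1 (chirp a Y)) -{1}cY; ring.
apply: le_trans (modulusD _ _) _; rewrite modulusN modulusM modulusE1 mulr1.
have -> : 4 * a%:R * (X%:R^-1 - Y.+1%:R^-1) =
  4 * a%:R * (X%:R^-1 - Y%:R^-1) + 4 * a%:R * (Y%:R^-1 - Y.+1%:R^-1) :> R.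
  by move: (Y.+1%:R^-1 : R) => t; ring.
by apply: lerD (IH XY Ya') (c_diff (leq_trans X0 XY) Ya).
Qed.

(** The constant is 7 = 1 + 2 + 4: the last term w = a - 1, split off because [abel] stops below a,
    the two boundary terms, and the variation of [c]. *)
Lemma chirp_tail X : (0 < X <= a)%N ->
  modulus (\sum_(X <= w < a) chirp a w) <= 7 * a%:R / X%:R.
Proof.
move=> /andP[X0]; have X0' : 0 < X%:R :> R by rewrite ltr0n.
rewrite leq_eqVlt => /predU1P[<-|Xa].
  by rewrite big_geq // modulus0 mulfK ?gt_eqF.
have a0 := leq_ltn_trans (leq0n X) Xa.
have a1 : (a.-1 < a)%N by rewrite ltn_predL.
have Xa1 : (X <= a.-1)%N by rewrite -ltnS prednK.
have h := abel (introT andP (conj X0 Xa1)) a1.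
have -> : \sum_(X <= w < a) chirp a w = chirp a a.-1 + (c a.-1 * chirp a a.-1 - c X * chirp a X) +
  (\sum_(X <= w < a.-1) chirp a w - (c a.-1 * chirp a a.-1 - c X * chirp a X)).
  by rewrite -{1}(prednK a0) big_nat_recr //=; ring.
apply: le_trans (modulusD _ _) _; apply: le_trans (lerD (modulusD _ _) h) _.
rewrite modulusE1; have h1 := modulusD (c a.-1 * chirp a a.-1) (- (c X * chirp a X)).
rewrite modulusN !modulusM !modulusE1 !mulr1 in h1.
have h2 := c_le (introT andP (conj (leq_trans X0 Xa1) a1)).
have h3 := c_le (introT andP (conj X0 Xa)).
have X1 : X%:R <= a.-1%:R :> R by rewrite ler_nat.
have Xa' : X%:R <= a%:R :> R by rewrite ler_nat ltnW.
have h4 : a%:R / a.-1%:R <= a%:R / X%:R :> R.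
  by rewrite ler_wpM2l // lef_pV2 ?posrE // (lt_le_trans X0').
have h5 : 1 <= a%:R / X%:R :> R by rewrite ler_pdivlMr // mul1r.
have h6 : 0 <= (a.-1%:R)^-1 :> R by rewrite invr_ge0 ler0n.
rewrite -[7 * _ / _]mulrA; set t := a%:R / X%:R in h3 h4 h5 *.
have h7 : 4 * a%:R * (X%:R^-1 - a.-1%:R^-1) <= 4 * t.
  by rewrite -mulrA ler_pM2l // ler_wpM2l // ; lra.
by lra.
Qed.

End Tail.
End QuadraticChirp.

(** * Scaling and comparison of the sums over a full period *)

Section GaussianRay.
Variable R : realType.
Local Notation E := (E R).
Local Notation chirp := (chirp R).

Lemma sum_mul_nat (V : nmodType) (m n : nat) (F : nat -> V) :
  \sum_(w < m * n) F w = \sum_(x < m) \sum_(y < n) F (x + m * y)%N.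
Proof.
rewrite exchange_big /=; elim: n => [|n IH]; first by rewrite muln0 !big_ord0.
by rewrite mulnSr big_split_ord big_ord_recr /= IH; congr (_ + _); apply: eq_bigr => i _; rewrite addnC.
Qed.

Lemma sum_unity_roots (F : fieldType) (z : F) k :
  z ^+ k = 1 -> \sum_(y < k) z ^+ y = (if z == 1 then k%:R else 0).
Proof.
move=> zk; have [->|z1] := eqVneq z 1.
  by under eq_bigr do rewrite expr1n; rewrite sumr_const card_ord.
have /esym/eqP := subrX1 z k.
by rewrite zk subrr mulf_eq0 subr_eq0 (negPf z1) => /eqP.
Qed.

Lemma chirp_refl a v : (0 < a)%N -> (v <= a.*2)%N -> chirp a (a.*2 - v) = chirp a v.
Proof.
move=> a0 va; apply: E_eq; rewrite natrB // -muln2 natrM.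
have -> : (a%:R * 2 - v%:R) ^+ 2 / (4 * a%:R) - v%:R ^+ 2 / (4 * a%:R) = a%:R - v%:R :> rat.
  by field; rewrite pnatr_eq0 -lt0n.
by rewrite rpredB ?natr_int.
Qed.

Definition gaussian (a : nat) : R[i] := \sum_(w < a.*2) chirp a w.

(** The reflection w -> 2 a - w carries the upper half of the period to 1, ..., a, which leaves the
    two endpoint terms. *)
Lemma gaussian_fold a : (0 < a)%N ->
  modulus (gaussian a - 2 * \sum_(0 <= w < a) chirp a w) <= 2.
Proof.
move=> a0; have -> : gaussian a - 2 * \sum_(0 <= w < a) chirp a w = chirp a a - chirp a 0.
  have e : \sum_(w < a.*2) chirp a w =
      \sum_(w < a) chirp a w + \sum_(w < a) chirp a w.+1.
    rewrite -addnn big_split_ord /=; congr (_ + _).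
    rewrite (reindex_inj rev_ord_inj) /=; apply: eq_bigr => i _.
    by rewrite addnBA // addnn chirp_refl // -addnn (leq_trans (ltn_ord i)) ?leq_addr.
  have : \sum_(w < a.+1) chirp a w = chirp a 0 + \sum_(w < a) chirp a w.+1.
    by rewrite big_ord_recl.
  rewrite /gaussian e big_mkord big_ord_recr /= => h.
  by rewrite -[\sum_(w < a) chirp a w.+1](addKr (chirp a 0)) -h; ring.
by apply: le_trans (modulusD _ _) _; rewrite modulusN !modulusE1; lra.
Qed.

(** For w = x + 2 a k y the phase is that of x plus x y / k, modulo integers. The sum over y is thus
    geometric and vanishes unless k divides x; the surviving x = k w give back the terms of
    [gaussian a]. *)
Lemma gaussian_scale a k : (0 < a)%N -> (0 < k)%N ->
  gaussian (a * k ^ 2) = k%:R * gaussian a.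
Proof.
move=> a0 k0.
have a0' : a%:R != 0 :> rat by rewrite pnatr_eq0 -lt0n.
have k0' : k%:R != 0 :> rat by rewrite pnatr_eq0 -lt0n.
rewrite /gaussian; have -> : (a * k ^ 2).*2 = (k * a.*2 * k)%N by rewrite -!muln2; lia.
rewrite sum_mul_nat.
have inner x : \sum_(y < k) chirp (a * k ^ 2) (x + k * a.*2 * y) =
    chirp (a * k ^ 2) x * (if (k %| x)%N then k%:R else 0).
  have -> : (if (k %| x)%N then k%:R else 0 : R[i]) = \sum_(y < k) E (x%:R / k%:R) ^+ y.
    rewrite sum_unity_roots; last first.
      by rewrite -EX -[_ *+ k]mulr_natr mulfVK // E_int ?natr_int.
    congr (if _ then _ else _); apply/idP/eqP => [/dvdnP[q ->]|/E_eq1].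
      by rewrite natrM mulfK // E_int ?natr_int.
    move=> /intrP[z /(congr1 ( *%R^~ k%:R))] /eqP.
    rewrite divfK // -[k%:R]/(k%:Z%:~R) -[x%:R]/(x%:Z%:~R) -rmorphM eqr_int => /eqP h.
    by rewrite -[(_ %| _)%N]/(k%:Z %| x%:Z)%Z h dvdz_mull.
  rewrite mulr_sumr; apply: eq_bigr => y _; rewrite /chirp -EX -ED; apply: E_eq.
  rewrite -[X in _ - (_ + X)]mulr_natr !natrD !natrM -muln2 natrM ?natrX.
  set d := (X in X \is a _); have -> : d = (a * y ^ 2)%:R.
    by rewrite /d natrM ?natrX; field; rewrite a0' k0'.
  exact: natr_int.
pose G x := chirp (a * k ^ 2) x * (if (k %| x)%N then k%:R else 0).
rewrite (eq_bigr (fun x : 'I_(k * a.*2) => G x)) => [|x _]; last exact: inner.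
rewrite sum_mul_nat /G (bigD1 (Ordinal k0)) //= [X in _ + X]big1 ?addr0 => [|i ni]; last first.
  rewrite big1 // => j _; case: ifP => [|_]; last by rewrite mulr0.
  rewrite dvdn_addl ?dvdn_mulr // => /dvdn_leq h; case/negP: ni; apply/eqP/val_inj => /=.
  by apply/eqP; rewrite -leqn0 leqNgt; apply/negP => /h; rewrite leqNgt ltn_ord.
rewrite mulr_sumr; apply: eq_bigr => w _; rewrite add0n dvdn_mulr // mulrC.
congr (_ * E _); rewrite !natrM ?natrX; field.
by rewrite a0' k0'.
Qed.

Lemma chirp_compare a b X : (0 < a)%N -> (a <= b)%N ->
  modulus (\sum_(0 <= w < X) chirp a w - \sum_(0 <= w < X) chirp b w) <=
  2 * X%:R ^+ 3 * (b%:R - a%:R) / (a%:R * b%:R).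
Proof.
move=> a0 ab; have b0 := leq_trans a0 ab.
have a0' : 0 < a%:R :> R by rewrite ltr0n.
have b0' : 0 < b%:R :> R by rewrite ltr0n.
have ab' : a%:R <= b%:R :> R by rewrite ler_nat.
rewrite -sumrB; apply: le_trans (modulus_sum _ _ _) _.
pose M : R := 2 * X%:R ^+ 2 * (b%:R - a%:R) / (a%:R * b%:R).
have -> : 2 * X%:R ^+ 3 * (b%:R - a%:R) / (a%:R * b%:R) = \sum_(0 <= w < X) M.
  by rewrite sumr_const_nat subn0 -mulr_natl /M; ring.
rewrite [X in X <= _]big_seq [X in _ <= X]big_seq; apply: ler_sum => w.
rewrite mem_index_iota /= => wX.
set q := w%:R ^+ 2 / (4 * a%:R) - w%:R ^+ 2 / (4 * b%:R) : rat.
have -> : chirp a w - chirp b w = chirp b w * (E q - 1).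
  by rewrite mulrBr mulr1 /chirp -ED /q [_ + (_ - _)]addrC subrK.
rewrite modulusM modulusE1 mul1r; apply: le_trans (modulus_E_sub1_le _ _) _.
have -> : ratr q = w%:R ^+ 2 * (b%:R - a%:R) / (4 * (a%:R * b%:R)) :> R.
  by rewrite /q rmorphB /= !ratr_chirp; field; rewrite !gt_eqF.
rewrite ger0_norm; last first.
  by rewrite divr_ge0 ?mulr_ge0 ?exprn_ge0 ?ler0n // subr_ge0.
have -> : 8 * (w%:R ^+ 2 * (b%:R - a%:R) / (4 * (a%:R * b%:R))) =
    2 * w%:R ^+ 2 * (b%:R - a%:R) / (a%:R * b%:R) :> R.
  by field; rewrite !gt_eqF.
rewrite /M ler_pM2r ?invr_gt0 ?mulr_gt0 // ler_wpM2r ?subr_ge0 // ler_pM2l //.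
by rewrite ler_pXn2r ?nnegrE ?ler0n // ler_nat ltnW.
Qed.

(** Below the cutoff X the terms are compared one by one; above it both sums are bounded by
    [chirp_tail]. The constants double those of [gaussian_fold], [chirp_tail] and [chirp_compare].
    The cutoff stays free, since the head grows like X^3 and the tails like 1 / X. *)
Lemma gaussian_compare a b X : (0 < X <= a)%N -> (a <= b)%N ->
  modulus (gaussian a - gaussian b) <=
  4 + 14 * a%:R / X%:R + 14 * b%:R / X%:R + 4 * X%:R ^+ 3 * (b%:R - a%:R) / (a%:R * b%:R).
Proof.
move=> /andP[X0 Xa] ab; have a0 := leq_trans X0 Xa; have b0 := leq_trans a0 ab.
have Xb := leq_trans Xa ab.
have ta := @chirp_tail R a X (introT andP (conj X0 Xa)).
have tb := @chirp_tail R b X (introT andP (conj X0 Xb)).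
have fa := gaussian_fold a0; have fb := gaussian_fold b0.
have hd := chirp_compare X a0 ab.
rewrite (big_cat_nat (leq0n X) Xa) /= in fa; rewrite (big_cat_nat (leq0n X) Xb) /= in fb.
move: ta tb fa fb hd.
set A := \sum_(0 <= i < X) chirp a i; set A' := \sum_(X <= i < a) _.
set B := \sum_(0 <= i < X) chirp b i; set B' := \sum_(X <= i < b) _ => ta tb fa fb hd.
have -> : gaussian a - gaussian b =
  (gaussian a - 2 * (A + A')) - (gaussian b - 2 * (B + B')) + (1 + 1) * (A - B) +
   (1 + 1) * A' - (1 + 1) * B' by ring.
have m2 : modulus (1 + 1 : R[i]) <= 2.
  by apply: le_trans (modulusD _ _) _; rewrite -(E0 R) modulusE1; lra.
have tri (p q x y z : R[i]) :
    modulus (p - q + x + y - z) <= modulus p + modulus q + modulus x + modulus y + modulus z.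
  by do 4! (rewrite (le_trans (modulusD _ _)) // ?modulusN lerD2r).
apply: le_trans (tri _ _ _ _ _) _; rewrite !modulusM.
have dbl (z : R[i]) r : modulus z <= r -> modulus (1 + 1) * modulus z <= 2 * r.
  by move=> h; apply: ler_pM; rewrite ?modulus_ge0.
have := dbl _ _ ta; have := dbl _ _ tb; have := dbl _ _ hd.
set x := modulus _ * _; set y := modulus _ * _; set z := modulus _ * _.
lra.
Qed.

End GaussianRay.

(** * The phase of [gaussian a], by approximation *)

Section GaussianPhase.
Variable R : realType.
Local Notation E := (E R).

(* gaussian (a k^2) = k gaussian a is compared with gaussian (k'^2) = k' gaussian 1, where k'^2 is
   the least square above a k^2. *)
Lemma gaussian_near a (C : nat) : (0 < a)%N -> (0 < C)%N ->
  exists2 r : R, 1 <= r & modulus (gaussian R a - r%:C * gaussian R 1) <= 71 * a%:R / C%:R.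
Proof.
(* With cutoff X = C k and k'^2 <= 4 a k^2, the tails amount to at most (14 + 56) a k / C. Head and
   folding errors amount to at most 8 C^3 + 4 C^3, which the choice k = 12 C^4 bounds by a k / C.
   Dividing by k gives the constant 71. *)
move=> a0 C0; pose k := (12 * C ^ 4)%N; pose A := (a * k ^ 2)%N.
have k0 : (0 < k)%N by rewrite muln_gt0 expn_gt0 C0.
have ex : exists j, (A <= j ^ 2)%N by exists A; rewrite -mulnn; case: A => // n; rewrite leq_pmulr.
case: (ex_minnP ex) => k' Ak' k'min.
have kk' : (k <= k')%N.
  rewrite -leq_sqr; apply: leq_trans Ak'. exact: leq_pmull.
have k'0 := leq_trans k0 kk'.
have pk' : (k'.-1 ^ 2 < A)%N.
  by rewrite ltnNge; apply/negP => /k'min; rewrite leqNgt ltn_predL k'0.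
have Ck : (C <= k)%N.
  by rewrite /k expnS mulnCA leq_pmulr // muln_gt0 expn_gt0 C0.
have XA : (0 < C * k <= A)%N.
  by rewrite muln_gt0 C0 k0 /A -mulnn mulnA leq_mul // (leq_trans Ck) // leq_pmull.
have := @gaussian_compare R A (k' ^ 2) (C * k) XA Ak'.
rewrite /A gaussian_scale // -{1}(mul1n (k' ^ 2)%N) (gaussian_scale _ (isT : (0 < 1)%N)) //.
have kR : 0 < k%:R :> R by rewrite ltr0n.
have k'R : 0 < k'%:R :> R by rewrite ltr0n.
have CR : 1 <= C%:R :> R by rewrite ler1n.
have aR : 1 <= a%:R :> R by rewrite ler1n.
have kC : k%:R <= k'%:R :> R by rewrite ler_nat.
have AR : k'%:R ^+ 2 - a%:R * k%:R ^+ 2 <= 2 * k'%:R :> R.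
  have : k'.-1%:R ^+ 2 <= a%:R * k%:R ^+ 2 :> R by rewrite -!natrX -natrM ler_nat ltnW.
  have -> : k'.-1%:R = k'%:R - 1 :> R by rewrite -[in RHS](prednK k'0) -natr1; ring.
  by move=> h; nra.
have bA : k'%:R ^+ 2 <= 4 * (a%:R * k%:R ^+ 2) :> R.
  have := Ak'; have := pk'; move: k' k'0 {kk' k'min Ak' pk' k'R kC AR} => [//|[|j]] _ /= h1 h2.
    by rewrite -!natrX -!natrM ler_nat -/A; lia.
  by rewrite -!natrX -!natrM ler_nat -/A; nia.
have eA : (a * k ^ 2)%:R = a%:R * k%:R ^+ 2 :> R by rewrite natrM natrX.
rewrite eA (natrM _ C k) natrX.
set g := gaussian R a; set g1 := gaussian R 1 => h.
exists (k'%:R / k%:R); first by rewrite ler_pdivlMr // mul1r.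
have -> : g - (k'%:R / k%:R)%:C * g1 = (k%:R^-1)%:C * (k%:R * g - k'%:R * g1).
  rewrite rmorphM fmorphV !rmorph_nat; field.
  by rewrite pnatr_eq0 -lt0n.
rewrite modulusM modulus_real ?invr_ge0 ?ler0n // ler_pdivrMl //.
apply: le_trans h _.
have -> : k%:R * (71 * a%:R / C%:R) = 70 * (a%:R * k%:R / C%:R) + a%:R * k%:R / C%:R :> R.
  by field; rewrite gt_eqF //; lra.
have e1 : a%:R * k%:R ^+ 2 / (C%:R * k%:R) = a%:R * k%:R / C%:R :> R.
  by field; rewrite !gt_eqF //; lra.
have e2 : k'%:R ^+ 2 / (C%:R * k%:R) <= 4 * (a%:R * k%:R / C%:R) :> R.
  by rewrite -e1 mulrA ler_wpM2r // invr_ge0 mulr_ge0 ?ler0n.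
have e3 : (C%:R * k%:R) ^+ 3 * (k'%:R ^+ 2 - a%:R * k%:R ^+ 2) / (a%:R * k%:R ^+ 2 * k'%:R ^+ 2)
    <= 2 * C%:R ^+ 3 :> R.
  rewrite ler_pdivrMr ?mulr_gt0 ?exprn_gt0 ?(lt_le_trans ltr01 aR) //.
  apply: (le_trans (ler_wpM2l _ AR)); first by rewrite exprn_ge0 // mulr_ge0 ?ler0n.
  have -> : (C%:R * k%:R) ^+ 3 * (2 * k'%:R) = 2 * C%:R ^+ 3 * (k%:R ^+ 2 * k'%:R * k%:R) :> R by ring.
  have -> : 2 * C%:R ^+ 3 * (a%:R * k%:R ^+ 2 * k'%:R ^+ 2) =
    2 * C%:R ^+ 3 * (k%:R ^+ 2 * k'%:R * (a%:R * k'%:R)) :> R by ring.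
  rewrite ler_wpM2l ?mulr_ge0 ?exprn_ge0 ?ler0n // ler_wpM2l ?mulr_ge0 ?exprn_ge0 ?ler0n //.
  by nra.
have e4 : 12 * C%:R ^+ 3 <= a%:R * k%:R / C%:R :> R.
  rewrite ler_pdivlMr ?(lt_le_trans ltr01 CR) // /k natrM natrX -mulrA -exprSr.
  by rewrite ler_peMl // mulr_ge0 ?exprn_ge0 ?ler0n.
have e5 : 4 <= 4 * C%:R ^+ 3 :> R by rewrite -[X in X <= _]mulr1 ler_pM2l // exprn_ege1.
rewrite -![14 * _ / _]mulrA.
have -> (x y z : R) : 4 * x * y / z = 4 * (x * y / z) by ring.
by rewrite e1; lra.
Qed.

Lemma le0_archi (M x : R) : (forall C : nat, (0 < C)%N -> x <= M / C%:R) -> x <= 0.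
Proof.
move=> h; rewrite leNgt; apply/negP => x0.
have M0 : 0 < M by have := h 1%N isT; rewrite divr1; exact: lt_le_trans.
have := archi_boundP (ltW (divr_gt0 M0 x0)); set C := Num.bound _ => hC.
have C0 : (0 < C)%N by rewrite -(ltr0n R) (lt_trans _ hC) // divr_gt0.
have := h C C0; rewrite ler_pdivlMr ?ltr0n // leNgt => /negP; apply.
by rewrite mulrC -ltr_pdivrMr.
Qed.

Lemma modulus_ge_Re (z : R[i]) : `|complex.Re z| <= modulus z.
Proof. by have := normc_ge_Re z; rewrite modulusE lecR. Qed.

Lemma modulus_ge_Im (z : R[i]) : `|complex.Im z| <= modulus z.
Proof.
have := modulus_ge_Re (z * 'i); rewrite ReiNIm normrN modulusM.
suff -> : modulus 'i = 1 :> R by rewrite mulr1.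
by rewrite /modulus normc_def /= expr0n expr1n add0r sqrtr1.
Qed.

Lemma gaussian1_ray : exists2 s : R, 0 < s & gaussian R 1 = s%:C * E (1 / 8).
Proof.
(* The sum is 1 + E (1/4) = E (1/8) (E (-1/8) + E (1/8)). *)
exists (2 * cos (2 * pi * ratr (1 / 8))).
  rewrite mulr_gt0 // cos_gt0_pihalf // fmorph_div rmorph1 rmorph_nat.
  by have := @pi_gt0 R; move: pi => p p0; apply/andP; split; lra.
have -> : (2 * cos (2 * pi * ratr (1 / 8)))%:C = E (1 / 8) + E (- (1 / 8)).
  rewrite EN /E; simpc; apply/eqP; rewrite eq_complex /=; apply/andP; split; apply/eqP; ring.
rewrite mulrDl -!ED addNr E0 /gaussian !big_ord_recl big_ord0 addr0 /chirp addrC.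
by congr (_ + _); rewrite -(E0 R); congr (E _).
Qed.

(** The quotient z of the two sides is approximated arbitrarily well by reals that are at least s,
    so it is itself a real number that is at least s. The uniform bound 1 <= r in [gaussian_near] is
    what keeps z away from 0. *)
Lemma gaussian_ray a : (0 < a)%N -> ray (gaussian R a) (E (1 / 8)).
Proof.
move=> a0; have [s s0 e1] := gaussian1_ray.
pose z := gaussian R a / E (1 / 8).
have near (C : nat) : (0 < C)%N -> exists2 r : R, s <= r & modulus (z - r%:C) <= 71 * a%:R / C%:R.
  move=> C0; have [r r1 h] := gaussian_near a0 C0.
  exists (r * s); first by rewrite ler_peMl // ltW.
  suff -> : modulus (z - (r * s)%:C) = modulus (gaussian R a - r%:C * gaussian R 1) by [].
  rewrite -[RHS]mulr1 -(modulusE1 R (- (1 / 8))) -modulusM; congr modulus.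
  rewrite e1 ENV rmorphM /z; field.
  exact: E_neq0.
have Im0 : complex.Im z = 0.
  apply/eqP; rewrite -normr_le0; apply: (@le0_archi (71 * a%:R)) => C /near[r _ h].
  have := le_trans (modulus_ge_Im _) h.
  by case: (z) => x y /=; rewrite subr0.
have Re0 : s <= complex.Re z.
  rewrite -subr_le0; apply: (@le0_archi (71 * a%:R)) => C /near[r rs h].
  have := le_trans (modulus_ge_Re _) h; case: (z) => x y /=.
  by rewrite distrC => /(le_trans (ler_norm _)); lra.
exists z; last by rewrite /z mulfVK // E_neq0.
by rewrite (complexE z) Im0 mulr0 addr0 ltcR (lt_le_trans s0).
Qed.

End GaussianPhase.

(** * Sums over matrices modulo N *)

(** Every nonempty fibre of an additive map is a translate of the kernel. *)
Lemma sum_push (A : comNzRingType) (X Y : finZmodType) (phi : X -> Y) (f : Y -> A) :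
  {morph phi : x y / x + y} ->
  \sum_x f (phi x) = #|[pred x | phi x == 0]|%:R * \sum_(y in codom phi) f y.
Proof.
move=> phiD; have phi0 : phi 0 = 0 by apply: (addrI (phi 0)); rewrite -phiD !addr0.
rewrite (partition_big phi (mem (codom phi))) /=; last by move=> x _; exact: codom_f.
rewrite mulr_sumr; apply: eq_bigr => y /codomP[x0 ->{y}].
rewrite (eq_bigr (fun=> f (phi x0))); last by move=> x /eqP ->.
rewrite sumr_const mulr_natl; congr (_ *+ _).
rewrite -(card_imset [pred x | phi x == 0] (addIr x0)); apply: eq_card => x.
apply/idP/imsetP => [/eqP xx0|[z]].
  exists (x - x0); last by rewrite subrK.
  by rewrite inE; apply/eqP/(addIr (phi x0)); rewrite -phiD subrK add0r.
by rewrite inE => /eqP z0 ->; apply/eqP; rewrite phiD z0 add0r.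
Qed.

Section ModularSums.
Variable R : realType.

Lemma ray_push (X Y : finZmodType) (phi : X -> Y) (f : Y -> R[i]) :
  {morph phi : x y / x + y} ->
  ray (\sum_x f (phi x)) (\sum_(y in codom phi) f y).
Proof.
move=> phiD; rewrite (sum_push f phiD); apply: ray_scale.
rewrite ltr0n; apply/card_gt0P; exists 0; rewrite inE.
by apply/eqP/(addrI (phi 0)); rewrite -phiD !addr0.
Qed.

Lemma ray_push_surj (X Y : finZmodType) (phi : X -> Y) (f : Y -> R[i]) :
  {morph phi : x y / x + y} -> (forall y, exists x, y = phi x) ->
  ray (\sum_x f (phi x)) (\sum_y f y).
Proof.
move=> phiD surj; apply: ray_trans (ray_push f phiD) _.
by apply/ray_eq/eq_bigl => y; have [x ->] := surj y; rewrite codom_f.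
Qed.

Section OneModulus.
Variable N : nat.
(** The type ['Z_N] always has at least two elements, and is Z/N once 1 < N. *)
Hypothesis N1 : (1 < N)%N.

Definition mlift m n (X : 'M['Z_N]_(m, n)) : 'M[int]_(m, n) :=
  map_mx (fun x : 'Z_N => (x : nat)%:Z) X.
Definition mred m n (Y : 'M[int]_(m, n)) : 'M['Z_N]_(m, n) := map_mx intr Y.

Definition periodic m n (F : 'M[int]_(m, n) -> R[i]) :=
  forall Y Z, F (Y + N%:Z *: Z) = F Y.

(* A sum over matrices modulo N of a function of integral matrices, meant for N-periodic F. *)
Definition msum m n (F : 'M[int]_(m, n) -> R[i]) := \sum_(X : 'M['Z_N]_(m, n)) F (mlift X).

Lemma mliftK m n : cancel (@mlift m n) (@mred m n).
Proof. by move=> X; apply/matrixP=> i j; rewrite !mxE -pmulrn natr_Zp. Qed.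

Lemma intr_Zp0 (z : int) : (z%:~R == 0 :> 'Z_N) = (N %| z)%Z.
Proof.
have nat0 k : (k%:R == 0 :> 'Z_N) = (N %| k)%N.
  by rewrite -val_eqE /= val_Zp_nat.
by case: z => k; rewrite ?NegzE ?mulrNz ?oppr_eq0 -?pmulrn nat0 ?dvdzN dvdzE //= abszN.
Qed.

Lemma mred_eq m n (Y Y' : 'M[int]_(m, n)) :
  mred Y = mred Y' -> exists Z, Y = Y' + N%:Z *: Z.
Proof.
move=> /matrixP h.
exists (\matrix_(i, j) ((Y i j - Y' i j) %/ N)%Z); apply/matrixP=> i j; rewrite !mxE.
have : (N %| (Y i j - Y' i j)%R)%Z.
  by rewrite -intr_Zp0 rmorphB subr_eq0; apply/eqP; have := h i j; rewrite !mxE.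
by move=> /divzK; rewrite mulrC => ->; rewrite addrC subrK.
Qed.

Lemma mredD m n : {morph @mred m n : Y Z / Y + Z}.
Proof. by move=> Y Z; rewrite /mred map_mxD. Qed.

Lemma mred_scale m n (Z : 'M[int]_(m, n)) : mred (N%:Z *: Z) = 0.
Proof.
by apply/matrixP=> i j; rewrite !mxE; apply/eqP; rewrite intr_Zp0 dvdz_mulr.
Qed.

Lemma mredK m n (Y : 'M[int]_(m, n)) : exists Z, mlift (mred Y) = Y + N%:Z *: Z.
Proof. by apply: mred_eq; rewrite mliftK. Qed.

Lemma periodic_mred m n (F : 'M[int]_(m, n) -> R[i]) Y :
  periodic F -> F (mlift (mred Y)) = F Y.
Proof. by move=> pF; have [Z ->] := mredK Y; rewrite pF. Qed.

Lemma msum_shift m n (F : 'M[int]_(m, n) -> R[i]) Y :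
  periodic F -> msum (fun X => F (X + Y)) = msum F.
Proof.
move=> pF; rewrite /msum [RHS](reindex_inj (addIr (mred Y))) /=.
apply: eq_bigr => X _; rewrite -[X in _ = F (mlift (X + _))]mliftK -mredD.
by rewrite periodic_mred.
Qed.

Lemma eq_msum m n (F G : 'M[int]_(m, n) -> R[i]) : F =1 G -> msum F = msum G.
Proof. by move=> FG; apply: eq_bigr => X _; rewrite FG. Qed.

Lemma msum_row m n1 n2 (F1 : 'M[int]_(m, n1) -> R[i]) (F2 : 'M[int]_(m, n2) -> R[i]) :
  msum (fun X => F1 (lsubmx X) * F2 (rsubmx X)) = msum F1 * msum F2.
Proof.
rewrite /msum big_distrlr pair_big /=.
rewrite (reindex (fun p : 'M['Z_N]_(m, n1) * 'M['Z_N]_(m, n2) => row_mx p.1 p.2)) /=; last first.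
  exists (fun X => (lsubmx X, rsubmx X)) => [[X Y] _|X _] /=; last by rewrite hsubmxK.
  by rewrite row_mxKl row_mxKr.
apply: eq_bigr => -[X Y] _ /=.
by rewrite /mlift -map_lsubmx -map_rsubmx row_mxKl row_mxKr.
Qed.

End OneModulus.

(** The changes of variables below are instances of this one: congruence by a matrix invertible
    modulo N, the Chinese remainder map, change of modulus, scaling, and splitting off a radical
    vector. J induces an additive surjection of the residue groups, whose fibres have equal size. *)
Lemma msum_surj (N N' : nat) m n m' n' (J : 'M[int]_(m, n) -> 'M[int]_(m', n'))
    (F : 'M[int]_(m', n') -> R[i]) :
  (1 < N)%N -> (1 < N')%N -> {morph J : X Y / X + Y} -> periodic N' F ->
  (forall X, exists Z, J (N%:Z *: X) = N'%:Z *: Z) ->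
  (forall Y, exists X Z, Y = J X + N'%:Z *: Z) ->
  ray (msum N (fun X => F (J X))) (msum N' F).
Proof.
move=> N1 N'1 JD pF JN surj.
pose phi (X : 'M['Z_N]_(m, n)) := mred N' (J (mlift X)).
have phiE Y : phi (mred N Y) = mred N' (J Y).
  rewrite /phi; have [Z ->] := mredK N1 Y; have [Z' e] := JN Z.
  by rewrite JD mredD e mred_scale // addr0.
apply: ray_trans (ray_push_surj (phi := phi) (fun X => F (mlift X)) _ _).
- by apply/ray_eq/eq_bigr => X _; rewrite /phi periodic_mred.
- by move=> X Y; rewrite -[X]mliftK -[Y]mliftK -mredD !phiE JD mredD.
move=> Y; have [X [Z e]] := surj (mlift Y); exists (mred N X).
by rewrite phiE -[LHS]mliftK e mredD mred_scale // addr0.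
Qed.

Lemma msum_reduce (N k : nat) m n (F : 'M[int]_(m, n) -> R[i]) :
  (1 < N)%N -> (0 < k)%N -> periodic N F -> ray (msum (N * k) F) (msum N F).
Proof.
move=> N1 k0 pF; apply: (@msum_surj _ _ _ _ _ _ id) => //.
- by rewrite (leq_trans N1) // leq_pmulr.
- by move=> X; exists (k%:Z *: X); rewrite scalerA PoszM.
by move=> Y; exists Y, 0; rewrite scaler0 addr0.
Qed.

End ModularSums.

Section DiagonalSums.
Variable R : realType.
Local Notation E := (E R).

Lemma sum_Zp (V : nmodType) (K : nat) (F : nat -> V) : (1 < K)%N ->
  \sum_(w : 'Z_K) F w = \sum_(w < K) F w.
Proof.
move=> K1; transitivity (\sum_(0 <= w < (Zp_trunc K).+2) F w); first by rewrite big_mkord.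
by rewrite Zp_cast // big_mkord.
Qed.

(** The summand has period 2 |d|, so the sum is a multiple of one over a period; a negative d
    conjugates it. *)
Lemma chirp_sum (d : int) (K : nat) : (1 < K)%N -> d != 0 -> (`|d|.*2 %| K)%N ->
  ray (\sum_(w : 'Z_K) E ((w : nat)%:R ^+ 2 / (4 * d%:~R))) (E ((sgz d)%:~R / 8)).
Proof.
move=> K1 d0 /dvdnP[k Kk].
have k0 : (0 < k)%N by case: k Kk K1 => // ->.
have -> : \sum_(w : 'Z_K) E ((w : nat)%:R ^+ 2 / (4 * d%:~R)) =
          \sum_(w < K) E (w%:R ^+ 2 / (4 * d%:~R)).
  exact: (sum_Zp (fun w : nat => E (w%:R ^+ 2 / (4 * d%:~R)))).
rewrite Kk mulnC (sum_mul_nat _ _ (fun w : nat => E (w%:R ^+ 2 / (4 * d%:~R)))).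
have d0' : d%:~R != 0 :> rat by rewrite intr_eq0.
have -> : \sum_(x < `|d|.*2) \sum_(y < k) E ((x + `|d|.*2 * y)%:R ^+ 2 / (4 * d%:~R)) =
   k%:R * \sum_(x < `|d|.*2) E (x%:R ^+ 2 / (4 * d%:~R)).
  rewrite mulr_sumr; apply: eq_bigr => x _.
  rewrite (eq_bigr (fun=> E (x%:R ^+ 2 / (4 * d%:~R)))); last first.
  move=> y _; apply: E_eq; move: (nat_of_ord x) (nat_of_ord y) => {}x {}y.
  have -> : (x + `|d|.*2 * y)%:R ^+ 2 / (4 * d%:~R) - x%:R ^+ 2 / (4 * d%:~R) =
     ((sgz d * (x * y)%:Z + d * (y ^ 2)%:Z)%:~R) :> rat.
    rewrite natrD natrM -muln2 natrM rmorphD !rmorphM /= -?pmulrn ?natrM ?natrX.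
    have -> : `|d|%:R = (sgz d)%:~R * d%:~R :> rat.
      by rewrite -[LHS]/((`|d|%:Z)%:~R) abszEsg rmorphM.
    have s2 : (sgz d)%:~R * (sgz d)%:~R = 1 :> rat by case: sgzP d0.
    by field: s2.
  exact: intr_int.
  by rewrite sumr_const card_ord [RHS]mulr_natl.
apply: ray_trans (ray_scale _ _) _; first by rewrite ltr0n.
case: d d0 d0' {Kk} => [[|d]|d] // _ d0'.
  apply: ray_trans (ray_eq _) (gaussian_ray R (isT : (0 < d.+1)%N)).
  by apply: eq_bigr => x _.
apply: ray_trans (ray_eq _) (ray_trans (ray_conj (gaussian_ray R (isT : (0 < d.+1)%N))) (ray_eq _)).
  rewrite rmorph_sum /=; apply: eq_bigr => x _; rewrite -EN /=; congr E.
  by rewrite NegzE rmorphN /= mulrN invrN mulrN.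
by rewrite -EN; congr E; rewrite sgzN.
Qed.

Lemma msum_prod (K m n : nat) (f : 'I_m -> 'I_n -> int -> R[i]) :
  msum K (fun X : 'M[int]_(m, n) => \prod_i \prod_j f i j (X i j)) =
  \prod_i \prod_j \sum_(w : 'Z_K) f i j (w : nat)%:Z.
Proof.
rewrite pair_big /= bigA_distr_bigA /= /msum.
rewrite (reindex (fun g : {ffun 'I_m * 'I_n -> 'Z_K} => \matrix_(i, j) g (i, j))) /=; last first.
  exists (fun X : 'M_(m, n) => [ffun p => X p.1 p.2]) => [g|X] _.
    by apply/ffunP => -[i j]; rewrite ffunE mxE.
  by apply/matrixP => i j; rewrite mxE ffunE.
apply: eq_bigr => g _; rewrite pair_big /=; apply: eq_bigr => -[i j] _.
by rewrite !mxE.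
Qed.

(** Orthogonality of characters; h divides K so that the character is defined modulo K. *)
Lemma sum_character (K : nat) m n (h : int) (U : 'M[int]_(m, n)) : (1 < K)%N -> h != 0 ->
  (h %| K%:Z)%Z ->
  msum K (fun Y => E ((\tr (U *m Y^T))%:~R / h%:~R)) =
  if [forall i, forall j, (h %| U i j)%Z] then (K ^ (m * n))%:R else 0.
Proof.
move=> K1 h0 hK; have h0' : h%:~R != 0 :> rat by rewrite intr_eq0.
pose f i j (y : int) := E ((U i j * y)%:~R / h%:~R).
have -> : msum K (fun Y => E ((\tr (U *m Y^T))%:~R / h%:~R)) =
   \prod_i \prod_j \sum_(w : 'Z_K) f i j (w : nat)%:Z.
  rewrite -msum_prod; apply: eq_bigr => Y _; rewrite /mxtrace.
  under [in RHS]eq_bigr do rewrite -E_sum; rewrite -E_sum; congr E.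
  rewrite rmorph_sum mulr_suml; apply: eq_bigr => i _; rewrite mxE rmorph_sum mulr_suml.
  by apply: eq_bigr => j _; rewrite mxE.
have fsum i j : \sum_(w : 'Z_K) f i j (w : nat)%:Z = if (h %| U i j)%Z then K%:R else 0.
  pose z := E ((U i j)%:~R / h%:~R).
  have fE (w : nat) : f i j w = z ^+ w.
    rewrite /z -EX /f; congr E.
    by rewrite -mulr_natr rmorphM /= mulrAC.
  under eq_bigr do rewrite fE.
  have -> : \sum_(w : 'Z_K) z ^+ w = \sum_(w < K) z ^+ w.
    exact: (sum_Zp (fun w : nat => z ^+ w)).
  rewrite sum_unity_roots; last first.
    rewrite -EX E_int //; case/dvdzP: hK => q hK.
    have -> : (U i j)%:~R / h%:~R *+ K = (U i j * q)%:~R :> rat.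
      by rewrite -mulr_natr -[K%:R]/(K%:Z%:~R) hK !rmorphM /=; field.
    exact: intr_int.
  congr (if _ then _ else _); apply/eqP/idP => [/E_eq1|/dvdzP[q e]]; last first.
    by rewrite /z e rmorphM /= mulfK // E_int ?intr_int.
  move=> /intrP[q /(congr1 ( *%R^~ h%:~R))] /eqP.
  by rewrite divfK // -rmorphM eqr_int => /eqP ->; rewrite dvdz_mull ?dvdzz.
rewrite (eq_bigr (fun i => \prod_j (if (h %| U i j)%Z then K%:R else 0 : R[i]))); last first.
  by move=> i _; apply: eq_bigr => j _; exact: fsum.
case: ifPn => [/forallP hU|].
  rewrite (eq_bigr (fun=> K%:R ^+ n)); last first.
    move=> i _; rewrite (eq_bigr (fun=> K%:R)) ?prodr_const ?card_ord //.
    by move=> j _; rewrite (forallP (hU i) j).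
  by rewrite prodr_const card_ord -exprM mulnC natrX.
rewrite negb_forall => hU; have {hU}[i hU] := fintype.existsP hU.
rewrite negb_forall in hU; have {hU}[j hij] := fintype.existsP hU.
by rewrite (bigD1 i) //= (bigD1 j) //= (negPf hij) !mul0r.
Qed.

End DiagonalSums.

(** * Milgram's formula *)

Lemma sum_symmetric (V : nmodType) n (g : 'I_n -> 'I_n -> V) :
  (forall i j, g i j = g j i) ->
  \sum_i \sum_j g i j = \sum_i g i i + (\sum_(i < n) \sum_(j < n | (i < j)%N) g i j) *+ 2.
Proof.
move=> gC; have -> : \sum_i \sum_j g i j = \sum_(i < n) (g i i +
    (\sum_(j < n | (i < j)%N) g i j + \sum_(j < n | (j < i)%N) g i j)).
  apply: eq_bigr => i _; rewrite (bigD1 i) //=; congr (_ + _).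
  rewrite (bigID (fun j : 'I_n => (i < j)%N)) /=; congr (_ + _); apply: eq_bigl => j.
    by case: ltngtP => [ij|ji|/val_inj ->]; rewrite ?andbF ?eqxx // andbT; apply/eqP => e;
       rewrite e ltnn in ij.
  by case: ltngtP => [ij|ji|/val_inj ->]; rewrite ?andbF ?eqxx // andbT; apply/eqP => e;
     rewrite e ltnn in ji.
rewrite !big_split /= mulr2n; congr (_ + (_ + _)).
rewrite (exchange_big_dep xpredT) //=; apply: eq_bigr => i _.
by apply: eq_bigr => j _; rewrite gC.
Qed.

Lemma dvdz_mulr2n (x : int) : (2 %| x *+ 2)%Z.
Proof. by rewrite -[x *+ 2]mulr_natr dvdz_mull. Qed.

Definition even_diag n (G : 'M[int]_n) := forall i, (2 %| G i i)%Z.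

Lemma symmetricE (A : Type) n (G : 'M[A]_n) i j : G^T = G -> G i j = G j i.
Proof. by move=> {1}<-; rewrite mxE. Qed.

Lemma even_congr n m (G : 'M[int]_n) (Y : 'M[int]_(m, n)) :
  G^T = G -> even_diag G -> even_diag (Y *m G *m Y^T).
Proof.
move=> GT Ge i; rewrite mxE.
have -> : \sum_j (Y *m G) i j * Y^T j i = \sum_j \sum_k Y i k * G k j * Y i j.
  by apply: eq_bigr => j _; rewrite !mxE mulr_suml.
rewrite sum_symmetric => [|j k]; last by rewrite (symmetricE k j GT); ring.
rewrite rpredD //; last exact: dvdz_mulr2n.
by apply: rpred_sum => j _; rewrite mulrAC dvdz_mull.
Qed.

(** Off-diagonal terms pair up. It makes the lattice B' (x) G even as soon as G is, whatever the
    parity of B'. *)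
Lemma trace_even n (A H : 'M[int]_n) : A^T = A -> H^T = H -> even_diag H ->
  (2 %| \tr (A *m H))%Z.
Proof.
move=> AT HT He; rewrite /mxtrace.
have -> : \sum_i (A *m H) i i = \sum_i \sum_j A i j * H j i.
  by apply: eq_bigr => i _; rewrite mxE.
rewrite sum_symmetric => [|j k]; last by rewrite (symmetricE j k AT) (symmetricE k j HT).
rewrite rpredD //; last exact: dvdz_mulr2n.
by apply: rpred_sum => j _; rewrite dvdz_mull.
Qed.

Section CongruenceInverse.
Variables (F : fieldType) (n : nat) (P S S' D D' : 'M[F]_n).
Hypotheses (PS : P *m S *m P^T = D) (DD' : D *m D' = 1%:M) (S'S : S' *m S = 1%:M).

Lemma congr_right_inv : S *m P^T *m D' *m P = 1%:M.
Proof. by apply: mulmx1C; rewrite !mulmxA PS. Qed.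

Lemma congr_inv : P^T *m D' *m P = S'.
Proof.
by rewrite -[RHS]mulmx1 -congr_right_inv !mulmxA S'S mul1mx.
Qed.

Lemma congr_adj : \det P *: (S *m P^T *m D') = \adj P.
Proof.
by rewrite -[RHS]mul1mx -congr_right_inv -[RHS]mulmxA mul_mx_adj mul_mx_scalar.
Qed.

End CongruenceInverse.

(** The value of B (x) C at the element of Z^n (x) Z^m with coordinate matrix V. *)
Definition qform n m (B : 'M[int]_n) (C : 'M[int]_m) (V : 'M[int]_(n, m)) : int :=
  \tr (B *m V *m C *m V^T).

Section LatticeGaussSum.
Variable R : realType.
Local Notation E := (E R).

(* qchar N B C is e^(2 pi i (B (x) C / N)) on (Z/N)^n (x) (Z/N)^m. *)
Definition qchar n m N (B : 'M[int]_n) (C : 'M[int]_m) (V : 'M[int]_(n, m)) : R[i] :=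
  E ((qform B C V)%:~R / N%:R).

Definition qsum n m N (B : 'M[int]_n) (C : 'M[int]_m) : R[i] := msum N (qchar N B C).

Lemma qchar_eq n m n1 m1 N (B : 'M[int]_n) (B1 : 'M[int]_n1) (C : 'M[int]_m) (C1 : 'M[int]_m1)
    (V : 'M[int]_(n, m)) (V1 : 'M[int]_(n1, m1)) z :
  (0 < N)%N -> qform B C V = qform B1 C1 V1 + N%:Z * z -> qchar N B C V = qchar N B1 C1 V1.
Proof.
move=> N0 e; apply: E_eq; rewrite -mulrBl e rmorphD /= addrAC subrr add0r rmorphM /= mulrC.
by rewrite mulKf ?intr_int // pnatr_eq0 -lt0n.
Qed.

Lemma qchar_periodic n m N (B : 'M[int]_n) (C : 'M[int]_m) :
  (0 < N)%N -> periodic N (qchar N B C).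
Proof.
move=> N0 V Z; apply: (@qchar_eq _ _ _ _ _ _ _ _ _ _ _
  (\tr (B *m Z *m C *m V^T) + \tr (B *m V *m C *m Z^T) + N%:Z * qform B C Z)) => //.
rewrite /qform linearD linearZ /= !(mulmxDl, mulmxDr) -!(scalemxAl, scalemxAr).
by rewrite !linearD !linearZ /=; ring.
Qed.
Local Notation rat_mx := (map_mx (intr : int -> rat)).

(** The rows of P and Q span sublattices of finite index on which B' and G are diagonal; C / M is
    the inverse of G. *)
Variables (n m M : nat) (B B' P : 'M[int]_n) (G C Q : 'M[int]_m).
Variables (b : 'rV[int]_n) (c : 'rV[int]_m).
Hypotheses (M0 : (0 < M)%N) (B'T : B'^T = B') (BB' : B *m B' = 1%:M).
Hypotheses (GT : G^T = G) (GC : C *m G = (M%:Z)%:M) (Ge : even_diag G).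
Hypotheses (P0 : \det P != 0) (Q0 : \det Q != 0).
Hypotheses (Pb : P *m B' *m P^T = diag_mx b) (Qc : Q *m G *m Q^T = diag_mx c).
Hypotheses (b0 : forall i, b 0 i != 0) (c0 : forall j, c 0 j != 0).

Let bi : 'M[rat]_n := diag_mx (\row_i (b 0 i)%:~R^-1).
Let ci : 'M[rat]_m := diag_mx (\row_j (c 0 j)%:~R^-1).
Let p : int := \det P.
Let q : int := \det Q.

(** The inverse of the diagonal form b (x) c, that is, the form on the dual of the diagonal
    sublattice in dual coordinates. *)
Let form (W W' : 'M[int]_(n, m)) : rat :=
  \tr (bi *m rat_mx W *m ci *m (rat_mx W')^T).

Let rat_mxM k l r (X : 'M[int]_(k, l)) (Y : 'M[int]_(l, r)) :
  rat_mx (X *m Y) = rat_mx X *m rat_mx Y.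
Proof. exact: map_mxM. Qed.

Let rat_trmx k l (X : 'M[int]_(k, l)) : rat_mx X^T = (rat_mx X)^T.
Proof. by apply/matrixP => i j; rewrite !mxE. Qed.

Let Pb_rat : rat_mx P *m rat_mx B' *m (rat_mx P)^T = diag_mx (map_mx intr b).
Proof. by rewrite -rat_trmx -!rat_mxM Pb map_diag_mx. Qed.

Let Qc_rat : rat_mx Q *m rat_mx G *m (rat_mx Q)^T = diag_mx (map_mx intr c).
Proof. by rewrite -rat_trmx -!rat_mxM Qc map_diag_mx. Qed.

Let diag_inv k (d : 'rV[int]_k) : (forall i, d 0 i != 0) ->
  diag_mx (map_mx intr d) *m diag_mx (\row_i (d 0 i)%:~R^-1) = 1%:M :> 'M[rat]_k.
Proof.
move=> d0; rewrite mulmx_diag -diag_const_mx; congr diag_mx; apply/rowP => i.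
by rewrite !mxE mulfV // intr_eq0.
Qed.

Let BB'_rat : rat_mx B *m rat_mx B' = 1%:M.
Proof. by rewrite -rat_mxM BB' map_scalar_mx. Qed.

Let M0_rat : M%:R != 0 :> rat.
Proof. by rewrite pnatr_eq0 -lt0n. Qed.

Let CG_rat : (M%:R^-1 *: rat_mx C) *m rat_mx G = 1%:M.
Proof.
rewrite -scalemxAl -rat_mxM GC map_scalar_mx scale_scalar_mx /=.
by rewrite -[M%:~R]/(M%:R : rat) mulVf.
Qed.

(* J embeds the lattice into the dual of the diagonal sublattice, in coordinates; summing over
   translates by J leaves, by orthogonality, the dual lattice P V Q^T. *)
Let J (Y : 'M[int]_(n, m)) := P *m B' *m Y *m G *m Q^T.

(** Adjugates keep the formula integral. Reading it for all Y, the pairing of W with the lattice is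
    integral exactly when pq divides adj P W (adj Q)^T, that is, when W = P V Q^T. *)
Let form_J W Y :
  form W (J Y) = (\tr (\adj P *m W *m (\adj Q)^T *m Y^T))%:~R / (p * q)%:~R.
Proof.
have hP := congr_adj Pb_rat (diag_inv b0).
have hQ := congr_adj Qc_rat (diag_inv c0).
rewrite -/bi -/ci in hP hQ.
have ciT : ci^T = ci by rewrite tr_diag_mx.
have hQ' : \det (rat_mx Q) *: (ci *m rat_mx Q *m rat_mx G) = (\adj (rat_mx Q))^T.
  by rewrite -hQ linearZ /= !trmx_mul trmxK ciT -rat_trmx GT mulmxA.
have pq0 : (p * q)%:~R != 0 :> rat by rewrite intr_eq0 mulf_neq0.
apply: (mulIf pq0); rewrite divfK // rmorphM /=.
have -> : p%:~R = \det (rat_mx P) by rewrite det_map_mx.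
have -> : q%:~R = \det (rat_mx Q) by rewrite det_map_mx.
rewrite /form /J -trace_map_mx !rat_mxM !rat_trmx !map_mx_adj.
rewrite !trmx_mul trmxK -!rat_trmx B'T GT !rat_trmx -hP -hQ'.
rewrite -!scalemxAl -scalemxAr -scalemxAl !mxtraceZ mulrC -mulrA; congr (_ * (_ * _)).
by rewrite -!mulmxA [X in _ = \tr X]mulmxA [RHS]mxtrace_mulC -!mulmxA.
Qed.

Let formE W W' :
  form W W' = \sum_i \sum_j (W i j)%:~R * (W' i j)%:~R / (b 0 i * c 0 j)%:~R.
Proof.
rewrite /form /mxtrace; apply: eq_bigr => i _; rewrite mxE; apply: eq_bigr => j _.
rewrite mul_mx_diag mul_diag_mx !mxE rmorphM invfM /=; ring.
Qed.

Let formD W W' :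
  form (W + W') (W + W') = form W W + form W W' * 2 + form W' W'.
Proof.
rewrite !formE mulr_suml -!big_split /=; apply: eq_bigr => i _.
rewrite mulr_suml -!big_split /=; apply: eq_bigr => j _.
by rewrite !mxE rmorphD /=; ring.
Qed.

Let f (W : 'M[int]_(n, m)) : R[i] :=
  \prod_i \prod_j E ((W i j)%:~R ^+ 2 / (2 * (b 0 i * c 0 j)%:~R)).

Let f_form W : f W = E (form W W / 2).
Proof.
rewrite formE mulr_suml E_sum; apply: eq_bigr => i _; rewrite mulr_suml E_sum.
apply: eq_bigr => j _; congr E; set d := (b 0 i * c 0 j)%:~R.
by rewrite /d; field; rewrite !intr_eq0 b0 c0.
Qed.

(** Evenness of the lattice makes half of [form (J Y) (J Y)] an integer, so a translation merely
    multiplies f by a character of Y. *)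
Let f_shift W Y : f (W + J Y) =
  f W * E ((\tr (\adj P *m W *m (\adj Q)^T *m Y^T))%:~R / (p * q)%:~R).
Proof.
rewrite !f_form -ED formD; apply: E_eq; rewrite -form_J.
have -> : (form W W + form W (J Y) * 2 + form (J Y) (J Y)) / 2 -
  (form W W / 2 + form W (J Y)) = form (J Y) (J Y) / 2 by field.
have -> : form (J Y) (J Y) = (\tr (B' *m (Y *m G *m Y^T)))%:~R.
  rewrite form_J /J.
  have -> : \adj P *m (P *m B' *m Y *m G *m Q^T) *m (\adj Q)^T *m Y^T =
     (p * q) *: (B' *m (Y *m G *m Y^T)).
    have -> : \adj P *m (P *m B' *m Y *m G *m Q^T) *m (\adj Q)^T *m Y^T =
       (\adj P *m P) *m B' *m Y *m G *m (\adj Q *m Q)^T *m Y^T by rewrite trmx_mul !mulmxA.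
    rewrite !mul_adj_mx tr_scalar_mx mul_scalar_mx mul_mx_scalar -!scalemxAl !mulmxA scalerA.
    by rewrite mulrC.
  by rewrite mxtraceZ rmorphM mulrC mulKf // intr_eq0 mulf_neq0.
have /dvdzP[z ->] : (2 %| \tr (B' *m (Y *m G *m Y^T)))%Z.
  apply: trace_even => //; last exact: even_congr.
  by rewrite !trmx_mul trmxK GT mulmxA.
by rewrite rmorphM /= mulfK // intr_int.
Qed.

(** On the dual lattice the form is B (x) C / M; halving it produces the modulus 2 M. *)
Let f_image V : f (P *m V *m Q^T) = qchar (2 * M) B C V.
Proof.
have hP := congr_inv Pb_rat (diag_inv b0) BB'_rat.
have hQ := congr_inv Qc_rat (diag_inv c0) CG_rat.
rewrite -/bi -/ci in hP hQ.
rewrite f_form; congr E; rewrite /qform natrM invfM mulrCA [LHS]mulrC; congr (_ * _).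
rewrite mulrC.
rewrite -trace_map_mx !rat_mxM !rat_trmx -mxtraceZ /form !rat_mxM !rat_trmx !trmx_mul trmxK.
rewrite -hP scalemxAl scalemxAr -hQ.
by rewrite -!mulmxA [RHS]mxtrace_mulC -!mulmxA.
Qed.

(** A common multiple of the moduli involved: 2 M for [qchar], pq for the character of [f_shift],
    and 2 b_i c_j for the factors of f. *)
Let K := (2 * M * (`|(p * q)%R| * \prod_i \prod_j `|(b 0 i * c 0 j)%R|.*2))%N.

Let K1 : (1 < K)%N.
Proof.
suff : (0 < `|(p * q)%R| * \prod_i \prod_j `|(b 0 i * c 0 j)%R|.*2)%N.
  by rewrite /K; case: (M) M0 => // M' _; case: (X in (0 < X)%N) => // k _; rewrite mulnS; lia.
rewrite muln_gt0 absz_gt0 mulf_neq0 //= prodn_gt0 // => i; rewrite prodn_gt0 // => j.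
by rewrite double_gt0 absz_gt0 mulf_neq0.
Qed.

Let dvd_K i j : (`|(b 0 i * c 0 j)%R|.*2 %| K)%N.
Proof.
rewrite /K (bigD1 i) //= (bigD1 j) //=.
by apply/dvdn_mull/dvdn_mull/dvdn_mulr/dvdn_mulr.
Qed.

Let f_periodic : periodic K f.
Proof.
move=> W Z; apply: eq_bigr => i _; apply: eq_bigr => j _; apply: E_eq.
have /dvdzP[k Kk] : (((b 0 i * c 0 j) * 2)%R %| K%:Z)%Z.
  by rewrite dvdzE abszM muln2 dvd_K.
rewrite !mxE rmorphD rmorphM /= Kk.
have : b 0 i * c 0 j != 0 by rewrite mulf_neq0.
move: (b 0 i * c 0 j) => d; rewrite -(intr_eq0 rat) => d0.
have -> : ((W i j)%:~R + (k * (d * 2))%:~R * (Z i j)%:~R) ^+ 2 / (2 * d%:~R) -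
    (W i j)%:~R ^+ 2 / (2 * d%:~R) =
    (k * W i j * Z i j * 2 + k ^+ 2 * d * 2 * Z i j ^+ 2)%:~R :> rat.
  by rewrite rmorphD !rmorphM /=; field; exact: d0.
exact: intr_int.
Qed.

Let c_even j : (2 %| (c 0 j)%R)%Z.
Proof. by have := even_congr Q GT Ge j; rewrite Qc mxE eqxx mulr1n. Qed.

Let f_sum : ray (msum K f) (E (((\sum_i sgz (b 0 i)) * (\sum_j sgz (c 0 j)))%:~R / 8)).
Proof.
rewrite /f (msum_prod K (fun i j y => E (y%:~R ^+ 2 / (2 * (b 0 i * c 0 j)%:~R)))).
rewrite mulr_suml rmorph_sum mulr_suml E_sum; apply: ray_prod => i _.
rewrite mulr_sumr rmorph_sum mulr_suml E_sum; apply: ray_prod => j _.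
have /dvdzP[h ch] := c_even j; have h0 : h != 0.
  by apply: contraNneq (c0 j) => h0; rewrite ch h0 mul0r.
have bh0 : b 0 i * h != 0 by rewrite mulf_neq0.
have -> : sgz (b 0 i) * sgz (c 0 j) = sgz (b 0 i * h).
  by rewrite ch !sgzM mulr1.
apply: ray_trans (chirp_sum R K1 bh0 _).
  apply/ray_eq/eq_bigr => w _; congr E; rewrite ch -[(_%:Z)%:~R]/(_%:R); congr (_ / _).
  by rewrite !rmorphM /=; ring.
by rewrite (dvdn_trans _ (dvd_K i j)) // ch mulrA (abszM _ 2) muln2 -[X in (_ %| X)%N]muln2 dvdn_mulr.
Qed.

(* The lattice (Z^n (x) Z^m, B' (x) G) is even with dual form B (x) C / M; its Gauss sum over the
   discriminant group is that of the diagonal sublattice given by P and Q, up to the index. *)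
Theorem milgram :
  ray (qsum (2 * M) B C) (E (((\sum_i sgz (b 0 i)) * (\sum_j sgz (c 0 j)))%:~R / 8)).
Proof.
apply: ray_trans f_sum.
pose U W := \adj P *m W *m (\adj Q)^T.
have pq0 : p * q != 0 by rewrite mulf_neq0.
have pqK : (p * q %| K%:Z)%Z by rewrite dvdzE /K absz_nat dvdn_mull ?dvdn_mulr.
have sum_f : msum K f =
    \sum_(X | [forall i, forall j, (p * q %| U (mlift (N := K) X) i j)%Z]) f (mlift X).
  have Knm0 : (K ^ (n * m))%:R != 0 :> R[i].
    by rewrite pnatr_eq0 -lt0n expn_gt0 (ltnW K1).
  (* The sum is unchanged by each translation by J Y; summing over all Y inserts a complete
     character sum, which selects the X in the index set. *)
  apply: (mulfI Knm0).
  transitivity (\sum_(Y : 'M['Z_K]_(n, m)) msum K f).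
    by rewrite sumr_const card_mx card_ord Zp_cast // [LHS]mulr_natl.
  rewrite (eq_bigr (fun Y => msum K (fun W => f (W + J (mlift (N := K) Y))))); last first.
    by move=> Y _; rewrite msum_shift //; exact: f_periodic.
  rewrite exchange_big /= [in RHS]big_mkcond mulr_sumr; apply: eq_bigr => X _ /=.
  under eq_bigr do rewrite f_shift.
  rewrite -mulr_sumr.
  have := sum_character R (U (mlift X)) K1 pq0 pqK; rewrite /msum => ->.
  by case: ifP => _; rewrite ?mulr0 // mulrC.
rewrite sum_f.
pose T V := P *m V *m Q^T.
have TD V W : T (V + W) = T V + T W by rewrite /T mulmxDr mulmxDl.
have TZ a V : T (a *: V) = a *: T V by rewrite /T -scalemxAr -scalemxAl.
pose phi (X : 'M['Z_K]_(n, m)) := mred K (T (mlift X)).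
have phiE V : phi (mred K V) = mred K (T V).
  rewrite /phi; have [Z ->] := mredK K1 V.
  by rewrite TD TZ mredD mred_scale // addr0.
have phiD : {morph phi : X Y / X + Y}.
  by move=> X Y; rewrite -[X]mliftK -[Y]mliftK -mredD !phiE TD mredD.
have M1 : (1 < 2 * M)%N by case: (M) M0 => // M' _; rewrite mulnS.
pose k := (`|(p * q)%R| * \prod_i \prod_j `|(b 0 i * c 0 j)%R|.*2)%N.
have k0 : (0 < k)%N by move: K1; rewrite /K -/k; case: k => //; rewrite muln0.
apply: ray_trans (ray_sym (msum_reduce M1 k0 (qchar_periodic B C (ltnW M1)))) _.
rewrite -/K; apply: (@ray_trans _ (\sum_X f (mlift (phi X)))).
  by apply/ray_eq/eq_bigr => X _; rewrite /phi periodic_mred ?f_image //; exact: f_periodic.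
apply: ray_trans (ray_push (fun X => f (mlift X)) phiD) _.
(* The image of [phi] is exactly the index set selected by orthogonality. *)
apply/ray_eq/eq_bigl => X; apply/idP/forallP => [/codomP[V ->] i|dvdU].
  apply/forallP => j; have [Z] := mredK K1 (T (mlift V)); rewrite -/(phi V) => ->.
  have -> : U (T (mlift V) + K%:Z *: Z) = (p * q) *: mlift V + K%:Z *: U Z.
    rewrite /U mulmxDr mulmxDl -scalemxAr -scalemxAl; congr (_ + _).
    have -> : \adj P *m T (mlift V) *m (\adj Q)^T = (\adj P *m P) *m mlift V *m (\adj Q *m Q)^T.
      by rewrite /T trmx_mul !mulmxA.
    by rewrite !mul_adj_mx tr_scalar_mx mul_scalar_mx mul_mx_scalar scalerA mulrC.
  rewrite mxE [X in X + _]mxE [X in _ + X]mxE.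
  by apply: rpredD; apply: dvdz_mulr.
pose V : 'M[int]_(n, m) := \matrix_(i, j) (U (mlift X) i j %/ (p * q))%Z.
have UV : U (mlift X) = (p * q) *: V.
  by apply/matrixP => i j; rewrite [RHS]mxE [X in _ * X]mxE mulrC divzK // (forallP (dvdU i)).
have XV : mlift X = T V.
  have : (p * q) *: mlift X = (p * q) *: T V.
    rewrite -TZ -UV /T /U.
    have -> : P *m (\adj P *m mlift X *m (\adj Q)^T) *m Q^T =
       (P *m \adj P) *m mlift X *m (Q *m \adj Q)^T by rewrite trmx_mul !mulmxA.
    by rewrite !mul_mx_adj tr_scalar_mx mul_scalar_mx mul_mx_scalar scalerA mulrC.
  by move=> /matrixP e; apply/matrixP => i j; have := e i j; rewrite !mxE => /(mulfI pq0).
by apply/codomP; exists (mred K V); rewrite phiE -XV mliftK.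
Qed.

End LatticeGaussSum.

(** * Inertia and local diagonalization *)

Section Inertia.
Variables (F : realFieldType) (n : nat).

Let coord (S : {set 'I_n}) : 'M[F]_(#|S|, n) := \matrix_(k, i) (enum_val k == i)%:R.

Let coord_free (S : {set 'I_n}) (P : 'M[F]_n) : P \in unitmx -> \rank (coord S *m P) = #|S|.
Proof.
rewrite -row_free_unit => Pf; rewrite mxrankMfree //; apply/eqP/row_freeP.
exists (coord S)^T; apply/matrixP => k l; rewrite !mxE (bigD1 (enum_val k)) //= !mxE eqxx mul1r.
rewrite big1 => [|i /negPf ki]; last by rewrite !mxE [_ == i]eq_sym ki mul0r.
by rewrite addr0 (inj_eq enum_val_inj) eq_sym.
Qed.

Let coord_supp (S : {set 'I_n}) (x : 'rV[F]_#|S|) i : i \notin S -> (x *m coord S) 0 i = 0.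
Proof.
move=> iS; rewrite mxE big1 // => k _; rewrite mxE.
by case: eqP => [e|_]; [rewrite -e enum_valP in iS | rewrite mulr0].
Qed.

Let diag_form (w d : 'rV[F]_n) : (w *m diag_mx d *m w^T) 0 0 = \sum_i w 0 i ^+ 2 * d 0 i.
Proof.
by rewrite mul_mx_diag mxE; apply: eq_bigr => i _; rewrite !mxE; ring.
Qed.

(** Otherwise the span of the positive rows of P and that of the nonpositive rows of P' have
    dimensions adding up to more than n, and a nonzero common vector would have both a positive and
    a nonpositive value. *)
Let inertia_le (M P P' : 'M[F]_n) (d d' : 'rV[F]_n) :
  P \in unitmx -> P' \in unitmx -> P *m M *m P^T = diag_mx d -> P' *m M *m P'^T = diag_mx d' ->
  (#|[set i | (0 < d 0 i)%R]| <= #|[set i | (0 < d' 0 i)%R]|)%N.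
Proof.
move=> Pu P'u Pd P'd; set S := [set i | _]; set S' := [set i | _ < d' _ _].
rewrite leqNgt; apply/negP => lt.
have : (coord S *m P :&: coord (~: S') *m P')%MS != 0.
  rewrite -mxrank_eq0 -lt0n -(ltn_add2l (\rank (coord S *m P + coord (~: S') *m P')%MS)).
  rewrite mxrank_sum_cap !coord_free // addn0; apply: leq_ltn_trans (rank_leq_col _) _.
  by have := cardsC S'; rewrite card_ord => nE; rewrite -[X in (X < _)%N]nE ltn_add2r.
case/rowV0Pn => v; rewrite sub_capmx => /andP[/submxP[x vx] /submxP[y vy]] /negP[].
pose w := x *m coord S; pose w' := y *m coord (~: S').
have vw : v = w *m P by rewrite vx mulmxA.
have vw' : v = w' *m P' by rewrite vy mulmxA.
have e : \sum_i w 0 i ^+ 2 * d 0 i = \sum_i w' 0 i ^+ 2 * d' 0 i.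
  rewrite -!diag_form -Pd -P'd.
  have vMv (u : 'rV_n) (T : 'M_n) : u *m (T *m M *m T^T) *m u^T = (u *m T) *m M *m (u *m T)^T.
    by rewrite trmx_mul !mulmxA.
  by rewrite !vMv -vw -vw'.
have le0 : \sum_i w' 0 i ^+ 2 * d' 0 i <= 0.
  apply: sumr_le0 => i _; have [iS'|] := boolP (i \in ~: S').
    by rewrite mulr_ge0_le0 ?sqr_ge0 //; move: iS'; rewrite !inE leNgt.
  by move=> /(coord_supp y) w'0; rewrite /w' w'0 expr0n mul0r.
have ge0 i : true -> 0 <= w 0 i ^+ 2 * d 0 i.
  have [|/(coord_supp x) w0] := boolP (i \in S); last by rewrite /w w0 expr0n mul0r.
  by rewrite inE => d0 _; rewrite mulr_ge0 ?sqr_ge0 // ltW.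
have /eqP : \sum_i w 0 i ^+ 2 * d 0 i = 0.
  by apply/eqP; rewrite eq_le {1}e le0 sumr_ge0.
rewrite psumr_eq0 // => /allP w0.
suff -> : v = 0 by [].
rewrite vw; suff -> : w = 0 by rewrite mul0mx.
apply/rowP => i; rewrite [RHS]mxE; have [iS|/(coord_supp x) //] := boolP (i \in S).
have := w0 i (mem_index_enum i); rewrite implyTb mulf_eq0 expf_eq0 /= => /orP[/eqP //|].
by move: iS; rewrite inE => /gt_eqF ->.
Qed.

Lemma inertia (M P P' : 'M[F]_n) (d d' : 'rV[F]_n) :
  P \in unitmx -> P' \in unitmx -> P *m M *m P^T = diag_mx d -> P' *m M *m P'^T = diag_mx d' ->
  #|[set i | 0 < d 0 i]| = #|[set i | 0 < d' 0 i]|.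
Proof. by move=> Pu P'u Pd P'd; apply/eqP; rewrite eqn_leq !(inertia_le _ _ Pd P'd, inertia_le _ _ P'd Pd). Qed.

End Inertia.

Lemma signature_diag (R : realType) n (B P : 'M[int]_n) (d : 'rV[int]_n) :
  \det P != 0 -> P *m B *m P^T = diag_mx d ->
  signature (map_mx intr B : 'M[R]_n) = \sum_i sgz (d 0 i).
Proof.
move=> P0 Pd; pose dR : 'rV[R]_n := map_mx intr d.
have PR : map_mx intr P \in @unitmx R n.
  by rewrite unitmxE det_map_mx unitfE intr_eq0.
have PdR : map_mx intr P *m map_mx intr B *m (map_mx intr P)^T = diag_mx dR.
  have -> : (map_mx intr P)^T = map_mx intr P^T :> 'M[R]_n by apply/matrixP => i j; rewrite !mxE.
  by rewrite -!map_mxM /= Pd map_diag_mx.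
have -> : \sum_i sgz (d 0 i) = #|[set i | 0 < dR 0 i]|%:Z - #|[set i | dR 0 i < 0]|%:Z.
  have cardE (S : {set 'I_n}) : #|S|%:Z = \sum_i (i \in S)%:Z.
    by rewrite -sum1_card (big_morph Posz PoszD (erefl _)) big_mkcond; apply: eq_bigr => i _; case: ifP.
  rewrite !cardE -sumrB; apply: eq_bigr => i _; rewrite !inE !mxE ltr0z ltrz0.
  by case: sgzP.
rewrite /signature; set S := [set s | _]%classic.
have [P' [d' [P'u P'd' ->]]] : S (xget 0 S).
  by apply: xgetPex; exists (#|[set i | 0 < dR 0 i]|%:Z - #|[set i | dR 0 i < 0]|%:Z), (map_mx intr P), dR.
rewrite (inertia P'u PR P'd' PdR); congr (_ - _%:Z).
(* Negative entries are counted as positive entries for -B, to which [inertia] applies again. *)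
have neg (e : 'rV[R]_n) : [set i | e 0 i < 0] = [set i | 0 < (- e) 0 i].
  by apply/setP => i; rewrite !inE mxE oppr_gt0.
rewrite !neg; apply: (inertia (M := - map_mx intr B) P'u PR).
  by rewrite mulmxN mulNmx P'd' raddfN.
by rewrite mulmxN mulNmx PdR raddfN.
Qed.

Lemma ulsubmx00 (A : Type) m n (M : 'M[A]_(1 + m, 1 + n)) : ulsubmx M 0 0 = M 0 0.
Proof. by rewrite !mxE; congr (M _ _); apply/val_inj. Qed.

Section LocalDiagonalization.
Variable p : nat.
Hypotheses (p_pr : prime p) (p_odd : odd p).

Let punit (x : int) := ~~ (p%:Z %| x)%Z.

Let punitM x y : punit (x * y) = punit x && punit y.
Proof. by rewrite /punit !dvdzE abszM Euclid_dvdM // negb_or. Qed.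

Let punit1 : punit 1.
Proof. by rewrite /punit dvdzE /= dvdn1 neq_ltn prime_gt1 ?orbT. Qed.

Let punit_det_inv n (T T' : 'M[int]_n) : T *m T' = 1%:M -> punit (\det T).
Proof.
by move=> /(congr1 determinant); rewrite det_mulmx det1 => e; have := punit1; rewrite -e punitM => /andP[].
Qed.

Let punit_prod n (F : 'I_n -> int) : punit (\prod_i F i) -> forall i, punit (F i).
Proof. by move=> + i; rewrite (bigD1 i) //= punitM => /andP[]. Qed.

Let unit_entry n (B : 'M[int]_n.+1) : punit (\det B) -> exists i j, punit (B i j).
Proof.
move=> uB; apply: contrapT => h; case/negP: uB; rewrite /determinant.
apply: rpred_sum => s _; apply: dvdz_mull; rewrite (bigD1 ord0) //=; apply: dvdz_mulr.
by apply: contrapT => /negP u; apply: h; exists ord0, (s ord0).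
Qed.

(* If no diagonal entry is a unit, then B_ii + 2 B_ij + B_jj is one for a unit entry B_ij. *)
Let unit_corner n (B : 'M[int]_n.+1) : B^T = B -> punit (\det B) ->
  exists T : 'M_n.+1, punit (\det T) /\ punit ((T *m B *m T^T) 0 0).
Proof.
move=> BT uB.
have swap (A : 'M[int]_n.+1) i : punit (A i i) ->
    exists T : 'M_n.+1, punit (\det T) /\ punit ((T *m A *m T^T) 0 0).
  move=> uA; exists (tperm_mx 0 i); split.
    by apply: (@punit_det_inv _ _ (tperm_mx 0 i)); rewrite -perm_mxM tperm2 perm_mx1.
  have -> : (tperm_mx 0 i *m A *m (tperm_mx 0 i)^T) 0 0 = A i i; last by [].
  by rewrite tr_tperm_mx -xrowE -xcolE !mxE tpermL.
have [i [j uij]] := unit_entry uB.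
have [/swap //|] := boolP (punit (B i i)); rewrite negbK => nii.
have [/swap //|] := boolP (punit (B j j)); rewrite negbK => njj.
have ij : i != j by apply/eqP => e; rewrite e /punit njj in uij.
pose T : 'M[int]_n.+1 := 1%:M + delta_mx i j.
have TT' : T *m (1%:M - delta_mx i j) = 1%:M.
  rewrite mulmxDl !mulmxBr !mulmx1 mul1mx mul_delta_mx_0 1?eq_sym // subr0.
  by rewrite subrK.
have uT := punit_det_inv TT'.
have [] := swap (T *m B *m T^T) i.
  have -> : (T *m B *m T^T) i i = B i i + B j j + B i j * 2.
    have rT : row i T = delta_mx 0 i + delta_mx 0 j.
      by apply/rowP => k; rewrite !mxE eqxx /= ![k == _]eq_sym.
    have -> : (T *m B *m T^T) i i = (row i T *m B *m (row i T)^T) 0 0.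
      by rewrite -row_mul [RHS]mxE [LHS]mxE; apply: eq_bigr => k _; rewrite !mxE.
    rewrite rT linearD /= !trmx_delta !mulmxDl !mulmxDr -!rowE -!colE !mxE.
    by rewrite (symmetricE j i BT); ring.
  rewrite /punit rpredDl ?rpredD // -/(punit _) punitM uij /=.
  by rewrite /punit dvdzE /= dvdn_prime2 //; apply: contraL p_odd => /eqP ->.
move=> T1 [uT1 u1]; exists (T1 *m T); rewrite det_mulmx punitM uT1 uT; split => //.
by move: u1; rewrite trmx_mul !mulmxA.
Qed.

(** Diagonalization over Z_(p) with denominators cleared: P stays integral, with determinant prime
    to p. Besides its use at p itself, it diagonalizes over Q, for any odd p not dividing the
    determinant. *)
Lemma diag_local n (B : 'M[int]_n) : B^T = B -> ~~ (p%:Z %| \det B)%Z ->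
  exists (P : 'M_n) (d : 'rV_n), [/\ ~~ (p%:Z %| \det P)%Z, P *m B *m P^T = diag_mx d &
    forall i, ~~ (p%:Z %| (d 0 i)%R)%Z].
Proof.
suff main : B^T = B -> punit (\det B) -> exists (P : 'M_n) (d : 'rV_n),
    punit (\det P) /\ P *m B *m P^T = diag_mx d.
  move=> BT uB; have [P [d [uP e]]] := main BT uB; exists P, d; split => //.
  apply: punit_prod; rewrite -det_diag -e !det_mulmx det_tr !punitM.
  by rewrite -/(punit _) in uB; rewrite uP uB.
elim: n B => [|n IH] B BT uB.
  by exists 1%:M, 0; rewrite det1; split; [exact: punit1 | apply/matrixP => -[]].
have [T [uT ua]] := unit_corner BT uB.
have [B1 B1def] : exists B1 : 'M[int]_(1 + n), B1 = T *m B *m T^T by exists (T *m B *m T^T).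
have B1T : B1^T = B1 by rewrite B1def !trmx_mul trmxK BT mulmxA.
have uB1 : punit (\det B1) by rewrite B1def !det_mulmx det_tr !punitM uT uB.
pose a := B1 0 0; pose r := ursubmx B1; pose D := drsubmx B1.
have B1E : B1 = block_mx a%:M r r^T D.
  rewrite -[LHS]submxK; congr block_mx.
    by rewrite [LHS]mx11_scalar ulsubmx00.
  by rewrite /r trmx_ursub B1T.
have DT : D^T = D by rewrite /D trmx_drsub B1T.
(* Elimination with the unit pivot a; scaling the lower rows by a replaces division by a. *)
pose P1 : 'M[int]_(1 + n) := block_mx 1%:M 0 (- r^T) a%:M.
pose D1 := a *: (a *: D - r^T *m r).
have D1T : D1^T = D1 by rewrite /D1 linearZ linearB linearZ /= trmx_mul trmxK DT.
have P1E : P1 *m B1 *m P1^T = block_mx a%:M 0 0 D1.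
  rewrite B1E /P1 tr_block_mx !mulmx_block !tr_scalar_mx trmx0 linearN /= trmxK.
  rewrite !(mul1mx, mulmx1, mul0mx, mulmx0, addr0, add0r).
  rewrite !(mul_scalar_mx, mul_mx_scalar).
  by rewrite !scalerN !addNr mul0mx add0r /D1 mulNmx addrC.
have detP1 : \det P1 = a ^+ n by rewrite det_lblock det1 mul1r det_scalar.
have uan : punit (a ^+ n).
  rewrite -B1def -/a in ua.
  by elim: (n) => [|k IHk]; [exact: punit1 | rewrite exprS punitM IHk andbT].
have uD1 : punit (\det D1).
  have : punit (\det (P1 *m B1 *m P1^T)) by rewrite !det_mulmx det_tr !punitM detP1 uan uB1.
  by rewrite P1E (det_ublock a%:M 0 D1) punitM => /andP[].
have [P2 [d [uP2 e]]] := IH D1 D1T uD1.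
have [B2 [B2def detB2]] : exists B2 : 'M[int]_(1 + n), B2 = block_mx 1%:M 0 0 P2 /\ \det B2 = \det P2.
  by eexists; split; first reflexivity; rewrite det_ublock det1 mul1r.
exists (B2 *m P1 *m T), (row_mx a%:M d); split.
  by rewrite !det_mulmx !punitM detB2 uP2 detP1 uan uT.
transitivity (B2 *m (P1 *m B1 *m P1^T) *m B2^T).
  by rewrite B1def !trmx_mul !mulmxA.
rewrite P1E; apply: etrans (esym (diag_mx_row a%:M d)); rewrite -e B2def tr_block_mx !mulmx_block !trmx0 tr_scalar_mx.
rewrite !(mul1mx, mulmx1, mul0mx, mulmx0, addr0, add0r).
by congr block_mx; apply/matrixP => i j; rewrite !mxE !ord1.
Qed.

End LocalDiagonalization.

(** * Gauss sums of tensor products *)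

Section QuadraticSums.
Variable R : realType.
Local Notation E := (E R).
Local Notation qsum := (qsum R).
Local Notation qchar := (qchar R).

(* Tameness of the quadratic function x |-> x C x^T / N on (Z/N)^m. *)
Definition tame_mod (N : nat) m (C : 'M[int]_m) :=
  forall x y : 'rV[int]_m, 2 *: (x *m C) = N%:Z *: y -> (N%:Z %| qform 1%:M C x)%Z.

Lemma qformZr n m (B : 'M[int]_n) (C : 'M[int]_m) (V : 'M[int]_(n, m)) a :
  qform B (a *: C) V = a * qform B C V.
Proof. by rewrite /qform -scalemxAr -scalemxAl linearZ. Qed.

Lemma qformZ n m (B : 'M[int]_n) (C : 'M[int]_m) (V : 'M[int]_(n, m)) a :
  qform B C (a *: V) = a ^+ 2 * qform B C V.
Proof.
rewrite /qform [(a *: V)^T]linearZ /= -!(scalemxAr, scalemxAl) scalerA linearZ /=.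
by rewrite expr2.
Qed.

Lemma qsum_congr N n m (B P P' : 'M[int]_n) (C : 'M[int]_m) c : (1 < N)%N ->
  P^T *m P' = c%:M -> coprimez c N ->
  ray (qsum N (P *m B *m P^T) C) (qsum N B C).
Proof.
move=> N1 PP' /coprimezP[[u v] /= uv].
have <- : msum N (fun V => qchar N B C (P^T *m V)) = qsum N (P *m B *m P^T) C.
  apply: eq_msum => V; congr (E (_%:~R / _)); rewrite /qform trmx_mul trmxK.
  by rewrite !mulmxA mxtrace_mulC !mulmxA.
apply: msum_surj => //.
- by move=> X Y; rewrite mulmxDr.
- exact/qchar_periodic/ltnW.
- by move=> X; exists (P^T *m X); rewrite -scalemxAr.
move=> Y; exists (u *: (P' *m Y)), (v *: Y).
rewrite -scalemxAr mulmxA PP' mul_scalar_mx !scalerA -scalerDl [N%:Z * v]mulrC uv.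
by rewrite scale1r.
Qed.

Lemma qsum_diag N n m (d : 'rV[int]_n) (C : 'M[int]_m) :
  qsum N (diag_mx d) C = \prod_i qsum N ((d 0 i)%:M : 'M_1) C.
Proof.
rewrite /qsum /msum bigA_distr_bigA /=.
rewrite (reindex (fun g : {ffun 'I_n -> 'M['Z_N]_(1, m)} => \matrix_(i, j) g i 0 j)) /=; last first.
  exists (fun X : 'M['Z_N]_(n, m) => [ffun i => row i X]) => [g|X] _.
    by apply/ffunP => i; apply/rowP => j; rewrite ffunE !mxE.
  by apply/matrixP => i j; rewrite mxE ffunE mxE.
apply: eq_bigr => g _; rewrite -E_sum; congr E.
rewrite -mulr_suml -rmorph_sum /=; congr (_%:~R / _).
rewrite /qform /mxtrace; apply: eq_bigr => i _.
rewrite big_ord1 mul_scalar_mx -!scalemxAl [RHS]mxE -!mulmxA mul_diag_mx [LHS]mxE; congr (_ * _).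
rewrite [LHS]mxE [RHS]mxE; apply: eq_bigr => j _; congr (_ * _); first by rewrite !mxE.
by rewrite [LHS]mxE [RHS]mxE; apply: eq_bigr => k _; rewrite !mxE.
Qed.

Lemma qsum_eq_mod N n m (B B' D : 'M[int]_n) (C : 'M[int]_m) : (0 < N)%N ->
  B = B' + N%:Z *: D -> qsum N B C = qsum N B' C.
Proof.
move=> N0 e; apply: eq_msum => V; apply: (@qchar_eq _ _ _ _ _ _ _ _ _ _ _ _ (qform D C V)) => //.
by rewrite /qform e !mulmxDl linearD /= -!scalemxAl linearZ.
Qed.

Lemma qsum_conj N n m (B : 'M[int]_n) (C : 'M[int]_m) :
  qsum N (- B) C = ((qsum N B C)^*)%R.
Proof.
rewrite /qsum /msum rmorph_sum /=; apply: eq_bigr => X _; rewrite -EN; congr E.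
by rewrite /qform !mulNmx linearN /= rmorphN /= mulNr.
Qed.

(** Substitute V = N2 x + N1 y. The cross terms are multiples of N1 N2, and N2^2 / (N1 N2) = N2 / N1
    explains the factor N2 on C modulo N1. *)
Lemma qsum_mul N1 N2 n m (B : 'M[int]_n) (C : 'M[int]_m) :
  (1 < N1)%N -> (1 < N2)%N -> coprime N1 N2 ->
  ray (qsum (N1 * N2) B C) (qsum N1 B (N2%:Z *: C) * qsum N2 B (N1%:Z *: C)).
Proof.
move=> N11 N21 co; pose N := (N1 * N2)%N.
have N0 : (1 < N)%N by rewrite (leq_trans N11) // leq_pmulr // ltnW.
have r1 := msum_reduce N11 (ltnW N21) (qchar_periodic R B (N2%:Z *: C) (ltnW N11)).
have r2 := msum_reduce N21 (ltnW N11) (qchar_periodic R B (N1%:Z *: C) (ltnW N21)).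
rewrite mulnC in r2; apply: ray_trans (rayM r1 r2); rewrite -msum_row.
pose J (X : 'M[int]_(n, m + m)) := N2%:Z *: lsubmx X + N1%:Z *: rsubmx X.
apply: ray_sym.
have -> : msum (N1 * N2) (fun X : 'M_(n, m + m) => qchar N1 B (N2%:Z *: C) (lsubmx X) *
    qchar N2 B (N1%:Z *: C) (rsubmx X)) = msum (N1 * N2) (fun X => qchar (N1 * N2) B C (J X)).
  apply: eq_msum => X; rewrite -ED; apply: E_eq.
  set x := lsubmx X; set y := rsubmx X.
  have e3 : qform B C (J X) = N2%:Z ^+ 2 * qform B C x + N1%:Z ^+ 2 * qform B C y +
     N1%:Z * N2%:Z * (\tr (B *m x *m C *m y^T) + \tr (B *m y *m C *m x^T)).
    rewrite /J -/x -/y /qform linearD 2!linearZ /= !(mulmxDl, mulmxDr) -!(scalemxAl, scalemxAr).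
    by rewrite !linearD !linearZ /=; ring.
  rewrite !qformZr e3 !rmorphD !rmorphM /=.
  set d := (X in X \is a _).
  have -> : d = (- (\tr (B *m x *m C *m y^T) + \tr (B *m y *m C *m x^T)))%:~R.
    rewrite /d rmorphN rmorphD /=; field.
    by rewrite !pnatr_eq0 -!lt0n (ltnW N11) (ltnW N21).
  exact: intr_int.
apply: msum_surj => //.
- by move=> X Y; rewrite /J !linearD /= addrACA.
- exact/qchar_periodic/ltnW.
- move=> X; exists (J X); rewrite /J scalerDr !linearZ /= !scalerA.
  by congr (_ *: _ + _ *: _); rewrite mulrC.
move=> Y; have /coprimezP[[u v] /= uv] : coprimez N1 N2 by [].
exists (row_mx (v *: Y) (u *: Y)), 0.
rewrite /J row_mxKl row_mxKr !scalerA -scalerDl scaler0 addr0.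
by rewrite addrC [_ * u]mulrC [_ * v]mulrC uv scale1r.
Qed.

(** If x is in the radical of N2 C modulo N1, then N2 x is in that of C modulo N1 N2. *)
Lemma tame_mod_mul N1 N2 m (C : 'M[int]_m) : coprime N1 N2 ->
  tame_mod (N1 * N2) C -> tame_mod N1 (N2%:Z *: C).
Proof.
move=> co tC x y e; have /coprimezP[[u v] /= uv] : coprimez N1 N2 by [].
have := tC (N2%:Z *: x) ((2 * u) *: (x *m C) + v *: y).
rewrite qformZ qformZr PoszM => h.
rewrite -(@Gauss_dvdzr _ N2%:Z) //; apply: dvdz_trans (dvdz_mulr N2%:Z (dvdzz _)) _.
rewrite mulrA -expr2; apply: h.
have -> : 2 *: (N2%:Z *: x *m C) = N2%:Z *: (2 *: (x *m C)).
  by rewrite -scalemxAl !scalerA mulrC.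
have -> : 2 *: (x *m C) = N1%:Z *: ((2 * u) *: (x *m C) + v *: y).
  have -> (w : 'rV[int]_m) : N1%:Z *: ((2 * u) *: w + v *: y) = (2 * u * N1) *: w + v *: (N1%:Z *: y).
    by rewrite scalerDr !scalerA; congr (_ *: _ + _ *: _); ring.
  rewrite -e -scalemxAr !scalerA -scalerDl; congr (_ *: _).
  by rewrite -[LHS]mulr1 -uv; ring.
by rewrite !scalerA mulrC.
Qed.

(** Expand the squared modulus over differences Z. Orthogonality leaves the Z in the radical, where
    tameness makes the summand 1; Z = 0 is among them. *)
Lemma qsum1_neq0 N m (C : 'M[int]_m) : (1 < N)%N -> C^T = C -> tame_mod N C ->
  qsum N (1%:M : 'M_1) C != 0.
Proof.
move=> N1 CT tC; have N0 := ltnW N1; set B : 'M[int]_1 := 1%:M.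
have NR : N%:R != 0 :> rat by rewrite pnatr_eq0 -lt0n.
pose dual (Z : 'rV[int]_m) := [forall i, forall j, (N%:Z %| (2 *: (Z *m C)) i j)%Z].
suff : 0 < qsum N B C * ((qsum N B C)^*)%R.
  by apply: contraTneq => ->; rewrite mul0r ltxx.
have -> : qsum N B C * ((qsum N B C)^*)%R =
    \sum_(Z : 'M['Z_N]_(1, m)) (if dual (mlift Z) then (N ^ (1 * m))%:R else 0).
  rewrite {2}/qsum /msum rmorph_sum mulr_sumr.
  transitivity (\sum_(X : 'M['Z_N]_(1, m)) \sum_(Z : 'M['Z_N]_(1, m))
     qchar N B C (mlift Z + mlift X) * ((qchar N B C (mlift X))^*)%R).
    apply: eq_bigr => X _; rewrite -mulr_suml; congr (_ * _).
    exact: esym (msum_shift N1 (mlift X) (qchar_periodic R B C N0)).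
  rewrite exchange_big /=; apply: eq_bigr => Z _.
  have key (X : 'M['Z_N]_(1, m)) : qchar N B C (mlift Z + mlift X) * ((qchar N B C (mlift X))^*)%R =
     qchar N B C (mlift Z) * E ((\tr (2 *: (mlift Z *m C) *m (mlift X)^T))%:~R / N%:~R).
    move: (mlift Z) (mlift X) => z x.
    rewrite /qchar -EN -!ED; congr E; rewrite -!mulrDl -mulNr -mulrDl; congr (_ / _).
    rewrite -rmorphN -!rmorphD /=; congr (_%:~R).
    have sym : \tr (x *m C *m z^T) = \tr (z *m C *m x^T).
      by rewrite -mxtrace_tr !trmx_mul trmxK CT mulmxA.
    rewrite /qform linearD /= !(mulmxDl, mulmxDr) !mul1mx -scalemxAl !linearD linearZ /= sym.
    ring.
  rewrite (eq_bigr _ (fun X _ => key X)) -mulr_sumr.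
  have := sum_character R (2 *: (mlift Z *m C)) N1 (_ : N%:Z != 0) (dvdzz _).
  rewrite /msum => -> //; last by rewrite -lt0n.
  rewrite -/(dual _); case: ifP => [/forallP dZ|]; last by rewrite mulr0.
  suff -> : qchar N B C (mlift Z) = 1 by rewrite mul1r.
  pose y : 'rV[int]_m := \row_j ((2 *: (mlift Z *m C)) ord0 j %/ N%:Z)%Z.
  have e : 2 *: (mlift Z *m C) = N%:Z *: y.
    apply/rowP => j; rewrite [RHS]mxE [X in _ * X]mxE mulrC divzK //.
    exact: (forallP (dZ 0)).
  have /dvdzP[q e'] := tC _ _ e.
  by rewrite /qchar e' rmorphM /= mulfK // E_int ?intr_int.
rewrite (bigD1 0) //= ifT; last first.
  apply/forallP => i; apply/forallP => j.
  suff -> : mlift (0 : 'M['Z_N]_(1, m)) = 0 by rewrite mul0mx scaler0 mxE dvdz0.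
  by apply/matrixP => i' j'; rewrite !mxE.
rewrite ltr_pwDl ?ltr0n ?expn_gt0 ?N0 // sumr_ge0 // => Z _.
by case: ifP => _; rewrite ?ler0n.
Qed.

End QuadraticSums.

(** * Odd moduli *)

Section OddModulus.
Variable R : realType.
Local Notation E := (E R).
Local Notation qsum := (qsum R).

(* The values u x^2 and 1 - v y^2 with 0 <= x, y <= p/2 are p + 1 elements of F_p. *)
Lemma two_squares_mod (p : nat) (u v : int) : prime p -> odd p ->
  coprimez p u -> coprimez p v -> exists x y : int, (p%:Z %| (u * x ^+ 2 + v * y ^+ 2 - 1)%R)%Z.
Proof.
move=> p_pr p_odd pu pv.
have p0 (z : int) : (z%:~R == 0 :> 'F_p) = (p%:Z %| z)%Z.
  have nat0 k : (k%:R == 0 :> 'F_p) = (p %| k)%N.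
    by rewrite (dvdn_pcharf (pchar_Fp p_pr)).
  by case: z => k; rewrite ?NegzE ?mulrNz ?oppr_eq0 -?pmulrn nat0 ?dvdzN dvdzE //= abszN.
have unit_p z : coprimez p z -> z%:~R != 0 :> 'F_p.
  rewrite p0 coprimezE dvdzE /= prime_coprime //.
have p_half : (p = p./2.*2.+1)%N by rewrite -{1}(odd_double_half p) p_odd.
have p_half' : (p./2 < p)%N by lia.
have sq_inj (i j : 'I_(p./2.+1)) : (i : nat)%:R ^+ 2 = (j : nat)%:R ^+ 2 :> 'F_p -> i = j.
  wlog ij : i j / (i <= j)%N => [hw e|].
    by case: (leqP i j) => [|/ltnW] /hw; [apply | move=> h; apply/esym/h].
  move=> /eqP; rewrite eq_sym -subr_eq0 subr_sqr mulf_eq0 -natrB // -natrD.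
  rewrite -![_%:R]/((_%:Z)%:~R) !p0 !dvdzE /= => /orP[] pd; apply/val_inj => /=.
    apply/eqP; rewrite eqn_leq ij /= -subn_eq0 -[_ == _]negbK -lt0n; apply/negP => ji0.
    by move: pd; rewrite gtnNdvd // (leq_ltn_trans (leq_subr _ _)) // (leq_trans (ltn_ord j)).
  have := ltn_ord i; have := ltn_ord j; move: pd p_half; move: (nat_of_ord i) (nat_of_ord j) => a b.
  case: (posnP (b + a)) => [|ab0]; first by lia.
  by move=> /(dvdn_leq ab0); lia.
pose h (s : 'I_(p./2.+1) + 'I_(p./2.+1)) : 'F_p :=
  match s with inl i => u%:~R * (i : nat)%:R ^+ 2 | inr j => 1 - v%:~R * (j : nat)%:R ^+ 2 end.
have [h_inj|] := pselect (injective h).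
  have := leq_card h h_inj; rewrite card_sum (card_Fp p_pr) !card_ord.
  by lia.
move=> /existsNP[s /existsNP[t /not_implyP[e st]]].
have [i [j ij]] : exists i j : 'I_(p./2.+1), u%:~R * (i : nat)%:R ^+ 2 = 1 - v%:~R * (j : nat)%:R ^+ 2 :> 'F_p.
  case: s t e st => [i|i] [j|j] /= e st.
  - by case: st; congr inl; apply/sq_inj/(mulfI (unit_p _ pu)).
  - by exists i, j.
  - by exists j, i.
  - by case: st; congr inr; apply/sq_inj/(mulfI (unit_p _ pv))/oppr_inj/(addrI 1).
exists i%:Z, j%:Z; rewrite -p0.
have -> : (u * i%:Z ^+ 2 + v * j%:Z ^+ 2 - 1)%:~R =
    u%:~R * (i : nat)%:R ^+ 2 + v%:~R * (j : nat)%:R ^+ 2 - 1 :> 'F_p.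
  by rewrite rmorphB rmorphD !rmorphM.
by rewrite ij subrK subrr.
Qed.

(** Each p-th power gains one factor p: in z^p - 1 = (z - 1) (1 + z + ... + z^(p-1)) the second
    factor is congruent to p modulo p. *)
Lemma expn_prime_mod (p k : nat) (s : int) : (p%:Z %| (s - 1)%R)%Z ->
  ((p ^ k.+1)%N%:Z %| (s ^+ (p ^ k) - 1)%R)%Z.
Proof.
move=> ps; elim: k => [|k IH]; first by rewrite expn1 expn0 expr1.
set z := s ^+ (p ^ k) in IH; have -> : s ^+ (p ^ k.+1) = z ^+ p by rewrite -exprM -expnSr.
have pz : (p%:Z %| (z - 1)%R)%Z.
  by apply: dvdz_trans IH; rewrite expnS PoszM dvdz_mulr.
rewrite subrX1 expnSr PoszM dvdz_mul //.
have -> : \sum_(i < p) z ^+ i = \sum_(i < p) (z ^+ i - 1) + p%:Z.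
  by rewrite sumrB sumr_const card_ord -[1 *+ p]/(p%:R) natz subrK.
rewrite rpredD ?dvdzz //; apply: rpred_sum => i _.
by rewrite subrX1; apply: dvdz_mulr.
Qed.

Lemma ord2_ind (P : 'I_2 -> Prop) : P 0 -> P 1 -> forall i, P i.
Proof.
move=> P0 P1 [[|[|//]] hi].
  by have <- : 0 = Ordinal hi by exact/val_inj.
by have <- : 1 = Ordinal hi by exact/val_inj.
Qed.

Section OddPrimePower.
Variables (p k m : nat) (C : 'M[int]_m).
Hypotheses (p_pr : prime p) (p_odd : odd p).
Let N := (p ^ k.+1)%N.
Let g (u : int) := qsum N (u%:M : 'M_1) C.

Let N1 : (1 < N)%N.
Proof. by rewrite /N -(expn0 p) ltn_exp2l // prime_gt1. Qed.

Let coN w : coprimez p w -> coprimez w N.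
Proof. by move=> pw; rewrite coprimez_sym /N coprimezE /= coprime_pexpl. Qed.

Let co_one_mod s : (p%:Z %| (s - 1)%R)%Z -> coprimez p s.
Proof.
move=> ps; rewrite coprimezE prime_coprime // -[(_ %| _)%N]/(p%:Z %| s)%Z.
rewrite -(rpredBr _ ps) opprB addrC subrK.
by rewrite dvdzE /= dvdn1 neq_ltn prime_gt1 ?orbT.
Qed.

Let g_square u w : coprimez p w -> ray (g (u * w ^+ 2)) (g u).
Proof.
move=> /coN wN; have := @qsum_congr R N 1 m u%:M w%:M 1%:M C w N1 _ wN.
rewrite tr_scalar_mx mulmx1 -!scalar_mxM => /(_ erefl).
by rewrite [w * u]mulrC -mulrA -expr2.
Qed.

Let g_mod u v z : u = v + N%:Z * z -> g u = g v.
Proof.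
move=> ->; apply: (@qsum_eq_mod R N _ _ _ _ z%:M); first exact: ltnW.
by rewrite raddfD /= -scale_scalar_mx.
Qed.

(* s = 1 mod p is a square mod p^(k+1), since s^(p^k) = 1 and p^k + 1 is even. *)
Let g_one_mod s u : (p%:Z %| (s - 1)%R)%Z -> ray (g (u * s)) (g u).
Proof.
move=> ps; have ps' := co_one_mod ps.
have /dvdzP[t st] := expn_prime_mod k ps.
pose w := s ^+ ((p ^ k).+1)./2.
have w2 : w ^+ 2 = s * s ^+ (p ^ k).
  by rewrite /w -exprM muln2 -exprS halfK /= oddX p_odd orbT subn0.
have pw : coprimez p w by rewrite /w coprimezXr.
rewrite (@g_mod _ (u * w ^+ 2) (- (u * s * t))); first exact: g_square.
rewrite w2; have -> : s ^+ (p ^ k) = t * N%:Z + 1 by rewrite -st subrK.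
by ring.
Qed.

(* The forms <u, v> and <s, s u v> are equivalent when s = u x^2 + v y^2 is a unit. *)
Let g_mul u v : coprimez p u -> coprimez p v -> ray (g u * g v) (g 1 * g (u * v)).
Proof.
move=> pu pv; have [x [y ps]] := two_squares_mod p_pr p_odd pu pv.
set s := u * x ^+ 2 + v * y ^+ 2 in ps.
have gd (a b : int) : g a * g b = qsum N (diag_mx (\row_(i < 2) if i == 0 then a else b)) C.
  by rewrite qsum_diag !big_ord_recl big_ord0 mulr1 !mxE.
(* The first row represents s, the second is orthogonal to it for <u, v>, and det P = s; [P'] is the
   adjugate of the transpose of P. *)
pose P : 'M[int]_2 := \matrix_(i, j) if i == 0 then (if j == 0 then x else y)
                                     else (if j == 0 then - (v * y) else u * x).
pose P' : 'M[int]_2 := \matrix_(i, j) if i == 0 then (if j == 0 then u * x else v * y)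
                                     else (if j == 0 then - y else x).
have PP' : P^T *m P' = s%:M.
  apply/matrixP; apply: ord2_ind; apply: ord2_ind;
  by rewrite !mxE !big_ord_recl big_ord0 !mxE /= /s; ring.
have PBP : P *m diag_mx (\row_(i < 2) if i == 0 then u else v) *m P^T =
     diag_mx (\row_(i < 2) if i == 0 then s else s * (u * v)).
  rewrite mul_mx_diag; apply/matrixP; apply: ord2_ind; apply: ord2_ind;
  by rewrite !mxE !big_ord_recl big_ord0 !mxE /= /s; ring.
have ps' := coN (co_one_mod ps).
have := qsum_congr R (diag_mx (\row_(i < 2) if i == 0 then u else v)) C N1 PP' ps'.
rewrite PBP -!gd => h; apply: ray_trans (ray_sym h) _; apply: rayM.
  by rewrite -[s]mul1r; apply: g_one_mod.
by rewrite mulrC; apply: g_one_mod.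
Qed.

(** The extra factor [g 1] avoids the exponent n - 1, so that n = 0 is covered. *)
Let g_prod n (d : 'I_n -> int) : (forall i, coprimez p (d i)) ->
  ray (g 1 * \prod_i g (d i)) (g 1 ^+ n * g (\prod_i d i)).
Proof.
elim: n d => [|n IH] d pd.
  by rewrite !big_ord0 expr0 mulr1 mul1r; apply: ray_refl.
rewrite !big_ord_recr /=; set D := \prod_(i < n) d _.
apply: (@ray_trans _ (g 1 ^+ n * g D * g (d ord_max))).
  by rewrite mulrA; apply: rayM (IH _ _) (ray_refl _).
rewrite exprSr -!mulrA; apply: rayM (ray_refl _) _; apply: g_mul => //; rewrite /D.
by elim/big_ind: _ => // [|a b pa pb]; rewrite ?coprimezMr ?pa ?pb // coprimezE coprimen1.
Qed.

(** The hypothesis makes z^4 positive, so the phase of z is a fourth root of unity; this is how a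
    phase is known to lie in Q/Z. *)
Lemma ray_fourth_root (z : R[i]) : z != 0 -> ray (z ^+ 2) ((z^*)%R ^+ 2) ->
  exists b : QZ, ray z (expQZ R b).
Proof.
move=> z0 zz; have z4 : ray (z ^+ 4) 1.
  apply: (@ray_trans _ (z ^+ 2 * (z^*)%R ^+ 2)).
    by rewrite -[4%N]/(2 + 2)%N exprD; apply: rayM (ray_refl _) zz.
  by rewrite -exprMn -normCK -exprM; exists (`|z| ^+ (2 * 2)); rewrite ?mulr1 // exprn_gt0 ?normr_gt0.
pose w := z / `|z|; have zw : ray z w := ray_self z0.
have w1 : `|w| = 1 by rewrite normrM normfV normr_id divff // normr_eq0.
have w4 : w ^+ 4 = 1.
  have zw4 : ray (z ^+ 4) (w ^+ 4) := rayM zw (rayM zw (rayM zw zw)).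
  have [r r0] := ray_trans (ray_sym zw4) z4; rewrite mulr1 => e'.
  by rewrite e'; apply/eqP; rewrite -(gtr0_norm r0) -e' normrX w1 expr1n.
pose I := E (1 / 4).
have I2 : I ^+ 2 = -1.
  have : I ^+ 2 != 1.
    rewrite -EX; apply/eqP => /E_eq1 /intrP[j e].
    have : j * 2 = 1 by apply: (@intr_inj rat); rewrite rmorphM /= -e; field.
    by lia.
  have : (I ^+ 2) ^+ 2 = 1 by rewrite -exprM -EX E_int.
  by move/eqP; rewrite sqrf_eq1 => /orP[/eqP-> /eqP|/eqP].
have /eqP : (w - 1) * (w + 1) * ((w - I) * (w + I)) = 0.
  have -> : (w - 1) * (w + 1) * ((w - I) * (w + I)) = (w ^+ 2 - 1) * (w ^+ 2 - I ^+ 2) by ring.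
  by rewrite I2; have -> : (w ^+ 2 - 1) * (w ^+ 2 - -1) = w ^+ 4 - 1 by [ring]; rewrite w4 subrr.
have IE j : I ^+ j = expQZ R (\pi_QZ (1 / 4) *+ j) by rewrite expQZMn E_expQZ.
rewrite !mulf_eq0 !subr_eq0 !addr_eq0 -!orbA => /or4P[] /eqP e.
- by exists 0; rewrite expQZ0 -e.
- by exists (\pi_QZ (1 / 4) *+ 2); rewrite -IE I2 -e.
- by exists (\pi_QZ (1 / 4) *+ 1); rewrite -IE expr1 -e.
by exists (\pi_QZ (1 / 4) *+ 3); rewrite -IE exprS I2 mulrN1 -e.
Qed.

Lemma expQZ_conj (b : QZ) : ((expQZ R b)^*)%R = expQZ R (- b).
Proof. by rewrite expQZN expQZ_repr -EN ENV. Qed.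

(** The quantifier over B comes after b, so that moduli can be combined by adding phases. *)
Definition phase_mod N m (C : 'M[int]_m) (b : QZ) := forall n (B : 'M[int]_n),
  B^T = B -> \det B = 1 \/ \det B = -1 ->
  ray (qsum N B C) (expQZ R (b *~ signature (map_mx intr B : 'M[R]_n))).

Lemma odd_prime_power_phase : C^T = C -> tame_mod N C -> exists b, phase_mod N C b.
Proof.
move=> CT tC; have g1 : g 1 != 0 := qsum1_neq0 R N1 CT tC.
have gN1 : g (-1) = ((g 1)^*)%R by rewrite -qsum_conj /g raddfN.
have co1 : coprimez p 1 by rewrite coprimezE coprimen1.
have coN1 : coprimez p (-1) by rewrite coprimezE coprimen1.
have [b gb] : exists b : QZ, ray (g 1) (expQZ R b).
  apply: ray_fourth_root => //; rewrite -gN1 !expr2.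
  by apply: ray_sym; have := g_mul coN1 coN1; rewrite mulrNN mulr1.
exists b => n B BT detB.
have pB : ~~ (p%:Z %| \det B)%Z.
  by case: detB => ->; rewrite dvdzE /= dvdn1 neq_ltn prime_gt1 ?orbT.
have [P [d [pP Pd pd]]] := diag_local p_pr p_odd BT pB.
have coP x : ~~ (p%:Z %| x)%Z -> coprimez p x by rewrite coprimezE prime_coprime.
have P0 : \det P != 0 by apply: contraNneq pP => ->; rewrite dvdz0.
have cong := @qsum_congr R N n m B P (\adj (P^T)) C (\det P) N1 _ (coN (coP _ pP)).
rewrite mul_mx_adj det_tr in cong; have {}cong := cong erefl.
apply: ray_trans (ray_sym cong) _; rewrite Pd qsum_diag -/(g _).
rewrite (signature_diag R P0 Pd).
have detd : \prod_i d 0 i = \det B * \det P ^+ 2.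
  by rewrite -det_diag -Pd !det_mulmx det_tr; ring.
(* As det B is its own sign, the product of the d_i and that of their signs differ by the square of
   det P, which [g] does not see. *)
have sgd : \prod_i sgz (d 0 i) = \det B.
  rewrite -(big_morph (@sgz int) (@sgzM int) (sgz1 int)) detd sgzM expr2 sgzM mulz_sg P0 mulr1.
  by case: detB => ->.
have sg_co i : coprimez p (sgz (d 0 i)).
  by case: sgzP (pd i) => [->||] //; rewrite dvdz0.
have h1 := g_prod (fun i => coP _ (pd i)); have h2 := g_prod sg_co.
have h3 : ray (g 1 ^+ n * g (\prod_i d 0 i)) (g 1 ^+ n * g (\prod_i sgz (d 0 i))).
  by apply: rayM (ray_refl _) _; rewrite sgd detd; apply/g_square/coP.
have h := ray_trans h1 (ray_trans h3 (ray_sym h2)).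
rewrite mulrC [X in ray _ X]mulrC in h; apply: ray_trans (ray_cancel g1 h) _.
have -> : b *~ (\sum_i sgz (d 0 i)) = \sum_i b *~ sgz (d 0 i).
  exact: (big_morph (fun z => b *~ z) (mulrzDr b) (mulr0z b)).
rewrite (big_morph (expQZ R) (@expQZD R) (expQZ0 R)); apply: ray_prod => i _.
case: sgzP (pd i) => [->|_ _|_ _]; first by rewrite dvdz0.
- by rewrite mulr1z.
by rewrite gN1 mulrN1z -expQZ_conj; apply: ray_conj.
Qed.

End OddPrimePower.
End OddModulus.

(** * Composite moduli and coordinates in the radical *)

Section GeneralModulus.
Variable R : realType.
Local Notation E := (E R).
Local Notation qsum := (qsum R).
Local Notation phase_mod := (phase_mod R).

Lemma coprime_factor_ind (P : nat -> Prop) :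
  (forall p k, prime p -> P (p ^ k.+1)%N) ->
  (forall a b, (1 < a)%N -> (1 < b)%N -> coprime a b -> P a -> P b -> P (a * b)%N) ->
  forall N, (1 < N)%N -> P N.
Proof.
move=> Pprime Pmul N; have [n] := ubnP N; elim: n N => // n IH N /ltnSE Nn N1.
have [p p_pr pN] : exists2 p, prime p & (p %| N)%N.
  by exists (pdiv N); [exact: pdiv_prime | exact: pdiv_dvd].
have N0 := ltnW N1; have [q pq Nq] := pfactor_coprime p_pr N0.
have l0 : (0 < logn p N)%N by rewrite logn_gt0 mem_primes p_pr N0 pN.
have p1 : (1 < p ^ logn p N)%N by rewrite -(expn0 p) ltn_exp2l // prime_gt1.
have PP : P (p ^ logn p N)%N by rewrite -(prednK l0); apply: Pprime.
have [q1|q1] := leqP q 1.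
  have q0 : (0 < q)%N by move: N0; rewrite Nq; case: (q).
  have -> : N = (p ^ logn p N)%N; last exact: PP.
  by rewrite {1}Nq; have -> : q = 1%N by [lia]; rewrite mul1n.
rewrite Nq; apply: Pmul => //; first by rewrite coprime_sym coprimeXl.
apply: IH => //; apply: leq_trans Nn; rewrite [X in (_ <= X)%N]Nq.
by rewrite ltn_Pmulr // ltnW.
Qed.

Lemma phase_mod_mul N1 N2 m (C : 'M[int]_m) b1 b2 :
  (1 < N1)%N -> (1 < N2)%N -> coprime N1 N2 ->
  phase_mod N1 (N2%:Z *: C) b1 -> phase_mod N2 (N1%:Z *: C) b2 ->
  phase_mod (N1 * N2) C (b1 + b2).
Proof.
move=> N11 N21 co h1 h2 n B BT detB; rewrite mulrzDl expQZD.
apply: ray_trans (qsum_mul R B C N11 N21 co) _.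
exact: rayM (h1 _ _ BT detB) (h2 _ _ BT detB).
Qed.

Lemma phase_coprime_mul N1 N2 m (C : 'M[int]_m) :
  (forall D : 'M[int]_m, D^T = D -> tame_mod N1 D -> exists b, phase_mod N1 D b) ->
  (forall D : 'M[int]_m, D^T = D -> tame_mod N2 D -> exists b, phase_mod N2 D b) ->
  (1 < N1)%N -> (1 < N2)%N -> coprime N1 N2 -> C^T = C -> tame_mod (N1 * N2) C ->
  exists b, phase_mod (N1 * N2) C b.
Proof.
move=> h1 h2 N11 N21 co CT tC.
have [||b1 hb1] := h1 (N2%:Z *: C); first by rewrite linearZ /= CT.
  exact: tame_mod_mul.
have [||b2 hb2] := h2 (N1%:Z *: C); first by rewrite linearZ /= CT.
  by apply: tame_mod_mul; rewrite 1?coprime_sym // mulnC.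
by exists (b1 + b2); apply: phase_mod_mul.
Qed.

Lemma odd_phase N m (C : 'M[int]_m) : (1 < N)%N -> odd N -> C^T = C -> tame_mod N C ->
  exists b, phase_mod N C b.
Proof.
move=> N1; move: N N1 C; apply: coprime_factor_ind => [p k p_pr C|a b a1 b1 co IHa IHb C].
  by rewrite oddX /= => p_odd; apply: odd_prime_power_phase.
rewrite oddM => /andP[oa ob] CT tC; apply: phase_coprime_mul => // D; [exact: IHa | exact: IHb].
Qed.

Lemma dvdz_mx m n (h : int) (A : 'M[int]_(m, n)) :
  (forall i j, (h %| A i j)%Z) -> exists Z, A = h *: Z.
Proof.
move=> hA; exists (\matrix_(i, j) (A i j %/ h)%Z); apply/matrixP => i j.
by rewrite !mxE mulrC divzK.
Qed.

(* A vector x in the radical with unit coordinate i: as xCx = 0 mod N, translating by multiples of x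
   clears coordinate i without changing the summand. *)
Lemma drop_coordinate N m (C : 'M[int]_m.+1) (x y : 'rV[int]_m.+1) i :
  (1 < N)%N -> C^T = C -> tame_mod N C -> 2 *: (x *m C) = N%:Z *: y -> coprimez (x 0 i) N ->
  let C' := row' i (col' i C) in
  tame_mod N C' /\ forall n (B : 'M[int]_n), B^T = B -> ray (qsum N B C) (qsum N B C').
Proof.
move=> N1 CT tC xy xi C'; have N0 := ltnW N1.
pose L : 'M[int]_(m, m.+1) := row' i 1%:M.
have LE k (A : 'M[int]_(k, m)) a j : (A *m L) a (lift i j) = A a j.
  rewrite mxE (bigD1 j) //= !mxE eqxx mulr1 big1 ?addr0 // => l lj.
  by rewrite !mxE (inj_eq lift_inj) (negPf lj) mulr0.
have L0 k (A : 'M[int]_(k, m)) a : (A *m L) a i = 0.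
  by rewrite mxE big1 // => l _; rewrite !mxE eq_sym (negPf (neq_lift _ _)) mulr0.
have LT k (A : 'M[int]_(k, m.+1)) : A *m L^T = col' i A.
  apply/matrixP => a j; rewrite !mxE (bigD1 (lift i j)) //= !mxE eqxx mulr1 big1 ?addr0 // => l lj.
  by rewrite !mxE eq_sym (negPf lj) mulr0.
have C'E : C' = L *m C *m L^T.
  apply/matrixP => a b; rewrite LT -[L *m C]trmxK trmx_mul CT LT !mxE.
  exact: symmetricE.
have qL n (B : 'M[int]_n) (X : 'M_(n, m)) : qform B C (X *m L) = qform B C' X.
  by rewrite /qform C'E trmx_mul !mulmxA.
split=> [x' y' e|n B BT].
  rewrite -qL; pose w := 2 *: (x' *m L *m C).
  have w_lift j : (N%:Z %| (w 0 (lift i j))%R)%Z.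
    have -> : w 0 (lift i j) = (2 *: (x' *m C')) 0 j by rewrite C'E !mulmxA LT !mxE.
    by rewrite e mxE dvdz_mulr.
  have [|z wz] := @dvdz_mx _ _ N%:Z w; last exact: (tC _ z).
  move=> a j; rewrite ord1; case: (unliftP i j) => [j' ->|->] //.
  rewrite -(@Gauss_dvdzl _ _ (x 0 i)) 1?coprimez_sym //.
  (* Pairing w with the radical vector x gives 0 modulo N, and so do all terms but the one at i;
     hence N divides w_i x_i, where x_i is a unit. *)
  have : (N%:Z %| (\sum_k w 0 k * x 0 k)%R)%Z.
    have -> : \sum_k w 0 k * x 0 k = (x' *m L *m (2 *: (x *m C))^T) 0 0.
      have -> : x' *m L *m (2 *: (x *m C))^T = w *m x^T.
        by rewrite /w linearZ /= trmx_mul CT -scalemxAr -scalemxAl !mulmxA.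
      by rewrite mxE; apply: eq_bigr => k _; rewrite [X in _ = _ * X]mxE.
    by rewrite xy linearZ /= -scalemxAr mxE dvdz_mulr.
  rewrite (bigD1 i) //= rpredDr // rpred_sum // => k ki.
  by case: (unliftP i k) ki => [k' -> _|->]; rewrite ?eqxx // dvdz_mulr.
have /coprimezP[[u v] /= uv] := xi.
have /dvdzP[q qx] := tC x y xy.
pose J (Y : 'M[int]_(n, 1 + m)) := lsubmx Y *m x + rsubmx Y *m L.
have JE Y : qchar R N B C (J Y) = 1 * qchar R N B C' (rsubmx Y).
  rewrite mul1r; apply: (@qchar_eq _ _ _ _ _ _ _ _ _ _ _ _
    (\tr (B *m (rsubmx Y *m L) *m y^T *m (lsubmx Y)^T) +
     q * \tr (B *m lsubmx Y *m (lsubmx Y)^T))) => //.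
  rewrite -qL /J; move: (lsubmx Y) (rsubmx Y *m L) => z V.
  have xCx : x *m C *m x^T = (q * N)%:M.
    by rewrite -qx /qform mul1mx [LHS]mx11_scalar /mxtrace big_ord1.
  have sym : \tr (B *m (z *m x) *m C *m V^T) = \tr (B *m V *m C *m (z *m x)^T).
    by rewrite -[LHS]mxtrace_tr !trmx_mul !trmxK CT BT -!mulmxA [RHS]mxtrace_mulC -!mulmxA.
  have cross : 2 * \tr (B *m V *m C *m (z *m x)^T) = N%:Z * \tr (B *m V *m y^T *m z^T).
    rewrite -!mxtraceZ; congr mxtrace.
    have -> : 2 *: (B *m V *m C *m (z *m x)^T) = B *m V *m (2 *: (x *m C))^T *m z^T.
      by rewrite linearZ /= !trmx_mul CT -!scalemxAr -!scalemxAl !mulmxA.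
    by rewrite xy linearZ /= -scalemxAr -scalemxAl.
  have sq : qform B C (z *m x) = N%:Z * (q * \tr (B *m z *m z^T)).
    rewrite /qform; have -> : B *m (z *m x) *m C *m (z *m x)^T = B *m z *m (x *m C *m x^T) *m z^T.
      by rewrite trmx_mul !mulmxA.
    by rewrite xCx mul_mx_scalar -scalemxAl linearZ /=; ring.
  rewrite /qform in sq *; rewrite linearD /= !(mulmxDl, mulmxDr) !linearD /= sq sym.
  rewrite mulrDr -cross; ring.
have sumJ : msum N (fun Y => qchar R N B C (J Y)) =
    msum N (fun _ : 'M[int]_(n, 1) => 1) * qsum N B C'.
  rewrite (eq_msum N JE).
  exact: (msum_row N (fun _ : 'M[int]_(n, 1) => 1) (qchar R N B C')).
have c0 : 0 < msum (R := R) N (fun _ : 'M[int]_(n, 1) => 1).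
  by rewrite /msum sumr_const ltr0n; apply/card_gt0P; exists 0.
apply: ray_sym; apply: ray_trans (ray_sym (ray_scale _ c0)) _.
rewrite -sumJ; apply: msum_surj => //.
- by move=> X Y; rewrite /J !linearD /= !mulmxDl addrACA.
- exact: qchar_periodic.
- by move=> X; exists (J X); rewrite /J !linearZ /= -!scalemxAl scalerDr.
move=> Y; pose z := u *: col i Y; pose W := Y - z *m x.
have Wi a : W a i = N%:Z * (v * Y a i).
  rewrite !mxE big_ord1 !mxE; rewrite -[X in X - _ = _]mul1r -uv; ring.
exists (row_mx z (col' i W)), (\matrix_(a, j) if j == i then v * Y a i else 0).
rewrite /J row_mxKl row_mxKr; apply/matrixP => a j.
rewrite [RHS]mxE [X in _ = X + _]mxE [X in _ = _ + X]mxE [X in _ = _ + _ * X]mxE.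
case: (unliftP i j) => [j' ->|->].
  by rewrite LE eq_sym (negPf (neq_lift _ _)) mulr0 addr0 !mxE addrC subrK.
by rewrite L0 eqxx -Wi addr0 /W [X in _ = _ + X]mxE [X in _ = _ + (_ + X)]mxE addrC subrK.
Qed.

End GeneralModulus.

(** * Powers of two *)

Section TwoPower.
Variable R : realType.
Local Notation E := (E R).
Local Notation qsum := (qsum R).
Local Notation phase_mod := (phase_mod R).

(** Infinite descent: half of a kernel vector is again an integral kernel vector. *)
Lemma det_neq0_of_even_kernel m (C : 'M[int]_m) :
  (forall x : 'rV[int]_m, x *m C = 0 -> exists y, x = 2 *: y) -> \det C != 0.
Proof.
move=> even_ker; apply/det0P => -[v v0 vC].
have [s] := ubnP (\sum_i `|(v 0 i)%R|)%N; elim: s v v0 vC => // s IH v v0 vC vs.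
have [y vy] := even_ker v vC.
have y0 : y != 0 by apply: contraNneq v0 => y0; rewrite vy y0 scaler0.
have yC : y *m C = 0.
  have : 2 *: (y *m C) = 0 by rewrite scalemxAl -vy.
  by move/eqP; rewrite scalemx_eq0 => /orP[] // /eqP.
apply: (IH y y0 yC).
have [i yi] : exists i, y 0 i != 0.
  by apply: contrapT => h; case/eqP: y0; apply/rowP => i; rewrite [RHS]mxE;
     apply/eqP; apply: contrapT => /negP yi; apply: h; exists i.
have vE j : `|(v 0 j)%R|%N = (2 * `|(y 0 j)%R|)%N by rewrite vy mxE abszM.
move: vs; rewrite (eq_bigr _ (fun j _ => vE j)) -big_distrr /=.
have : (0 < \sum_i `|(y 0 i)%R|)%N by rewrite (bigD1 i) //= addn_gt0 absz_gt0 yi.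
by move: (\sum_i _)%N => t; lia.
Qed.

Section EvenKernel.
Variables (k m : nat) (C : 'M[int]_m).
Let N := (2 ^ k.+1)%N.
Hypotheses (m0 : (0 < m)%N) (CT : C^T = C).
(** The situation once no vector of the radical has an odd coordinate. *)
Hypothesis even_ker : forall x y : 'rV[int]_m, 2 *: (x *m C) = N%:Z *: y -> exists z, x = 2 *: z.

Let detC : \det C != 0.
Proof.
apply: det_neq0_of_even_kernel => x xC; apply: (even_ker (y := 0)).
by rewrite xC !scaler0.
Qed.

(** The rows of G lie in the radical of C modulo N, hence are even. *)
Let halve (s N' : nat) (G : 'M[int]_m) : G^T = G -> C *m G = (2 ^ (k + s) * N')%N%:Z%:M ->
  exists G', G = 2 *: G'.
Proof.
move=> GT CG; have GC : G *m C = (2 ^ (k + s) * N')%N%:Z%:M.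
  by rewrite -[LHS]trmxK trmx_mul GT CT CG tr_scalar_mx.
apply: dvdz_mx => i j.
have [|z] := even_ker (x := row i G) (y := (2 ^ s * N')%N%:Z *: delta_mx 0 i).
  rewrite -row_mul GC rowE mul_mx_scalar !scalerA /N; congr (_ *: _).
  by rewrite -!PoszM expnS expnD; congr Posz; lia.
by move=> /rowP/(_ j); rewrite !mxE => ->; rewrite dvdz_mulr.
Qed.

(* Halving an integral multiple of the inverse of C until the power of 2 is exactly 2^k. *)
Let dual : exists (G : 'M[int]_m) (N' : nat),
  [/\ odd N', (1 < N')%N, G^T = G, even_diag G & C *m G = (2 ^ k * N')%N%:Z%:M].
Proof.
suff [G [N' [oN GT CG]]] : exists (G : 'M[int]_m) (N' : nat),
    [/\ odd N', G^T = G & C *m G = (2 ^ k * N')%N%:Z%:M].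
  have [G' G2] := halve (s := 0) GT (etrans CG (congr1 (fun j => (2 ^ j * N')%N%:Z%:M) (esym (addn0 k)))).
  (* One more halving at exponent k shows that all entries of G are even, whence [even_diag]. The
     factor 3 ensures 1 < N' and keeps N' odd. *)
  exists (3 *: G), (3 * N')%N; split.
  - by rewrite oddM oN.
  - by case: (N') oN => // N'' _; lia.
  - by rewrite linearZ /= GT.
  - by move=> i; rewrite G2 !mxE dvdz_mull // dvdz_mulr.
  by rewrite -scalemxAr CG scale_scalar_mx -PoszM; congr (Posz _)%:M; lia.
have main s : forall (G : 'M[int]_m) (N' : nat), odd N' -> G^T = G ->
    C *m G = (2 ^ (k + s) * N')%N%:Z%:M -> exists (G : 'M[int]_m) (N' : nat),
    [/\ odd N', G^T = G & C *m G = (2 ^ k * N')%N%:Z%:M].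
  elim: s => [|s IH] G N' oN GT CG; first by rewrite addn0 in CG; exists G, N'.
  have [G' G2] := halve GT CG; apply: (IH G' N') => //.
    apply/matrixP => i j; have /matrixP/(_ i j) := GT; rewrite G2 !mxE.
    by apply: mulfI.
  apply/matrixP => i j; have /matrixP/(_ i j) := CG; rewrite G2 -scalemxAr [LHS]mxE => e.
  apply: (@mulfI _ (2 : int)) => //; rewrite e addnS expnS -mulnA PoszM.
  by rewrite !mxE -mulrnAr.
pose h := `|\det C|%N; have h0 : (0 < h)%N by rewrite absz_gt0.
pose G := sgz (\det C) *: \adj C.
have GT : G^T = G by rewrite /G linearZ /= trmx_adj CT.
have [o ho hE] := pfactor_coprime (isT : prime 2) h0.
apply: (main (logn 2 h) (2 ^+ k *: G) o) => //.
- by rewrite -coprime2n.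
- by rewrite linearZ /= GT.
rewrite -!scalemxAr mul_mx_adj !scale_scalar_mx; congr (_%:M).
by rewrite -abszEsg -/h expnD -mulnA [(_ * o)%N]mulnC -hE PoszM; congr (_ * _); rewrite -[RHS]natz natrX.
Qed.

Lemma E_intM (z : int) (q : rat) : E (z%:~R * q) = expQZ R (\pi_QZ q *~ z).
Proof.
rewrite expQZMz E_expQZ; case: z => j.
  by rewrite -[E q ^ j]/(E q ^+ j) -EX -mulr_natl.
by rewrite -[E q ^ _]/((E q ^+ j.+1)^-1) -EX -ENV NegzE rmorphN mulNr -mulr_natl.
Qed.

(** Makes [diag_local] available for any nonsingular form when a diagonalization over Q is all that
    is wanted. *)
Lemma odd_prime_not_dvd (h : int) : h != 0 ->
  exists p, [/\ prime p, odd p & ~~ (p%:Z %| h)%Z].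
Proof.
move=> h0; have [p ph p_pr] := prime_above (2 + `|h|)%N; exists p; split=> //.
  by have [p2|//] := even_prime p_pr; move: ph; rewrite p2; lia.
by rewrite dvdzE /= gtnNdvd ?absz_gt0 // (leq_ltn_trans (leq_addl 2 _)).
Qed.

(* Milgram's formula for the lattice B^-1 (x) N' G splits as the sum modulo N, which is sought, times a
   sum of odd modulus N'^2. *)
Lemma even_kernel_phase : exists b, phase_mod N C b.
Proof.
have [G [N' [oN N'1 GT Ge CG]]] := dual.
pose M := (2 ^ k * N' ^ 2)%N; pose H := N'%:Z *: G.
have N1 : (1 < N)%N by rewrite /N expnS; have := expn_gt0 2 k; lia.
have N'21 : (1 < N' ^ 2)%N by rewrite -(exp1n 2) ltn_sqr.
have M0 : (0 < M)%N by rewrite muln_gt0 !expn_gt0 /= (ltnW N'1).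
have N'2 : (N' ^ 2)%N%:Z = N'%:Z ^+ 2 by rewrite -[LHS]natz natrX natz.
have N0' : (N'%:Z != 0) by rewrite eqz_nat -lt0n ltnW.
have HT : H^T = H by rewrite linearZ /= GT.
have He : even_diag H by move=> i; rewrite mxE dvdz_mull.
have CH : C *m H = (M%:Z)%:M.
  by rewrite -scalemxAr CG scale_scalar_mx -PoszM; congr (Posz _)%:M; rewrite /M; lia.
have detH : \det H != 0.
  have : \det (C *m H) != 0 by rewrite CH det_scalar expf_neq0 // eqz_nat -lt0n.
  by rewrite det_mulmx; apply: contraNneq => ->; rewrite mulr0.
have [q [q_pr q_odd qH]] := odd_prime_not_dvd detH.
have [Q [c [qQ Qc qc]]] := diag_local q_pr q_odd HT qH.
have Q0 : \det Q != 0 by apply: contraNneq qQ => ->; rewrite dvdz0.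
have c0 j : c 0 j != 0 by apply: contraNneq (qc j) => ->; rewrite dvdz0.
have coNN' : coprime N (N' ^ 2) by rewrite coprime_pexpl // coprime_pexpr // coprime2n.
have [b2 hb2] : exists b, phase_mod (N' ^ 2) (N%:Z *: C) b.
  apply: odd_phase => //; first by rewrite oddX oN orbT.
    by rewrite linearZ /= CT.
  (* Tameness modulo N'^2: multiplying by G shows that radical vectors are divisible by N', so their
     values are divisible by N'^2. *)
  move=> x y e; have [w xw] : exists w, x = N'%:Z *: w.
    apply: dvdz_mx => i j.
    have co : coprimez N'%:Z (2 * N%:Z * 2 ^+ k).
      rewrite coprimezE /= !abszM abszX /= coprime_sym.
      have -> : (2 * N * 2 ^ k = 2 ^ (1 + k.+1 + k))%N by rewrite /N !expnD expn1.
      by rewrite coprime_pexpl // coprime2n.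
    rewrite -(Gauss_dvdzr _ co).
    have : (N'%:Z *: (N'%:Z *: (y *m G))) i j = (2 * N%:Z * 2 ^+ k * N'%:Z) * x i j.
      have -> : N'%:Z *: (N'%:Z *: (y *m G)) = 2 *: (x *m (N%:Z *: C)) *m G.
        by rewrite e -scalemxAl scalerA -PoszM mulnn.
      rewrite -scalemxAr -!scalemxAl -mulmxA CG mul_mx_scalar !scalerA mxE; congr (_ * _).
      by rewrite PoszM -[(2 ^ k)%N%:Z]natz natrX; ring.
    rewrite [LHS]mxE [X in _ * X]mxE => e'.
    apply/dvdzP; exists ((y *m G) i j); apply: (mulfI N0').
    by rewrite [_ * N'%:Z]mulrC e'; ring.
  by rewrite N'2 xw qformZ dvdz_mulr.
pose s := \sum_j sgz (c 0 j).
(* The sum modulo 2 M = N N'^2 has phase sigma(B) s / 8, of which the odd modulus accounts for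
   sigma(B) b2. *)
exists (\pi_QZ (1 / 8) *~ s - b2) => n B BT detB.
pose B' := \det B *: \adj B.
have BB' : B *m B' = 1%:M.
  by rewrite -scalemxAr mul_mx_adj scale_scalar_mx; case: detB => ->.
have B'T : B'^T = B' by rewrite linearZ /= trmx_adj BT.
have detB' : ~~ (3%:Z %| \det B')%Z.
  have : \det B * \det B' = 1 by rewrite -det_mulmx BB' det1.
  by case: detB => -> /eqP; rewrite ?mul1r ?mulN1r ?eqr_oppLR => /eqP ->.
have [P [b [pP Pb pb]]] := diag_local (isT : prime 3) isT B'T detB'.
have P0 : \det P != 0 by apply: contraNneq pP => ->; rewrite dvdz0.
have b0 i : b 0 i != 0 by apply: contraNneq (pb i) => ->; rewrite dvdz0.
have sB : signature (map_mx intr B : 'M[R]_n) = \sum_i sgz (b 0 i).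
  (* B and its inverse are congruent through B', hence share the diagonal form b. *)
  apply: (@signature_diag R _ _ (P *m B')).
    by rewrite det_mulmx mulf_neq0 //; apply: contraNneq detB' => ->; rewrite dvdz0.
  by rewrite trmx_mul B'T -Pb -!mulmxA [B *m (B' *m _)]mulmxA BB' mul1mx.
have := milgram R M0 B'T BB' HT CH He P0 Q0 Pb Qc b0 c0.
rewrite -sB -/s; set t := signature _ => hM.
have : ray (qsum (N * N' ^ 2) B C) (expQZ R (\pi_QZ (1 / 8) *~ (t * s))).
  rewrite -E_intM mul1r.
  by have <- : (2 * M = N * N' ^ 2)%N by rewrite /M /N mulnA -expnS.
move=> {}hM; have hmul := qsum_mul R B C N1 N'21 coNN'.
have h2 := hb2 n B BT detB.
have h1 : ray (qsum N B ((N' ^ 2)%N%:Z *: C)) (qsum N B C).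
  have -> : qsum N B ((N' ^ 2)%N%:Z *: C) = msum N (fun V => qchar R N B C (N'%:Z *: V)).
    apply: eq_msum => V; congr (E (_%:~R / _)).
    by rewrite qformZr qformZ N'2.
  apply: msum_surj => //; first by move=> X Y; rewrite scalerDr.
  - exact/qchar_periodic/ltnW.
  - by move=> X; exists (N'%:Z *: X); rewrite !scalerA mulrC.
  move=> Y; have /coprimezP[[u v] /= uv] : coprimez N' N.
    by rewrite coprimezE /= coprime_sym coprime_pexpl // coprime2n.
  exists (u *: Y), (v *: Y); rewrite !scalerA -scalerDl [N'%:Z * u]mulrC [N%:Z * v]mulrC uv.
  by rewrite scale1r.
apply: (@ray_cancel R _ _ (expQZ R (b2 *~ t))); first exact: expQZ_neq0.
apply: ray_trans (rayM (ray_sym h1) (ray_sym h2)) _; apply: ray_trans (ray_sym hmul) _.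
apply: ray_trans hM _; apply: ray_eq; by rewrite -expQZD mulrzBl subrK [t * s]mulrC mulrzA.
Qed.

End EvenKernel.
Lemma qsum_dim0 N n (B : 'M[int]_n) (C : 'M[int]_0) : (1 < N)%N -> ray (qsum N B C) 1.
Proof.
move=> N1; have -> : qsum N B C = \sum_(X : 'M['Z_N]_(n, 0)) 1.
  apply: eq_bigr => X _; rewrite -(E0 R); congr E.
  by rewrite /qform [_ *m C]thinmx0 mul0mx linear0 mul0r.
rewrite sumr_const -[X in ray X]mulr1 mulr_natl; exists #|'M['Z_N]_(n, 0)|%:R; last by rewrite mulr1.
by rewrite ltr0n; apply/card_gt0P; exists 0.
Qed.

Lemma two_power_phase k m (C : 'M[int]_m) : C^T = C -> tame_mod (2 ^ k.+1) C ->
  exists b, phase_mod (2 ^ k.+1) C b.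
Proof.
have N1 : (1 < 2 ^ k.+1)%N by rewrite expnS; have := expn_gt0 2 k; lia.
elim: m C => [|m IH] C CT tC.
  by exists 0 => n B _ _; rewrite mul0rz expQZ0; apply: qsum_dim0.
have [[x [y [i [e xi]]]]|h] := pselect (exists (x y : 'rV[int]_m.+1) (i : 'I_m.+1),
    2 *: (x *m C) = (2 ^ k.+1)%N%:Z *: y /\ ~~ (2 %| (x 0 i)%R)%Z).
  have co : coprimez (x 0 i) (2 ^ k.+1)%N.
    by rewrite coprimez_sym coprimezE /= coprime_pexpl // prime_coprime.
  have [tC' qC'] := drop_coordinate R N1 CT tC e co.
  have [|b hb] := IH (row' i (col' i C)) _ tC'.
    by apply/matrixP => a c; rewrite !mxE; exact: symmetricE.
  by exists b => n B BT detB; apply: ray_trans (qC' n B BT) (hb n B BT detB).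
apply: even_kernel_phase => // x y e; apply: dvdz_mx => a i; rewrite ord1.
by apply: contrapT => /negP xi; apply: h; exists x, y, i.
Qed.

Theorem phase_mod_exists N m (C : 'M[int]_m) : (1 < N)%N -> C^T = C -> tame_mod N C ->
  exists b, phase_mod N C b.
Proof.
move=> N1; move: N N1 m C; apply: coprime_factor_ind => [p k p_pr m C|a b a1 b1 co IHa IHb m C].
  by case: (even_prime p_pr) => [->|p_odd]; [exact: two_power_phase | exact: odd_prime_power_phase].
by apply: phase_coprime_mul => // D; [exact: IHa | exact: IHb].
Qed.

End TwoPower.

(** * Finite quadratic functions *)

Section FiniteQuadraticFunction.
Variables (R : realType) (T : finZmodType) (psi : T -> QZ).
Hypotheses (psiQ : quadratic psi) (psiT : tame psi).
Local Notation E := (E R).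
Local Notation m := #|T|.

Let polarDl y : {morph (polar psi)^~ y : x x' / x + x'}. Proof. exact: psiQ.2.1. Qed.
Let polarDr x : {morph polar psi x : y y' / y + y'}. Proof. exact: psiQ.2.2. Qed.

Let polarC x y : polar psi x y = polar psi y x.
Proof. by rewrite /polar [x + y]addrC addrAC. Qed.

Let morphMz (U W : zmodType) (f : U -> W) x (a : int) : {morph f : x y / x + y} ->
  f (x *~ a) = f x *~ a.
Proof.
move=> fD; have f0 : f 0 = 0 by apply: (addrI (f 0)); rewrite -fD !addr0.
have fN y : f (- y) = - f y by apply: (addrI (f y)); rewrite -fD !subrr.
have fMn k : f (x *+ k) = f x *+ k by elim: k => // k IH; rewrite !mulrS fD IH.
by case: a => k; rewrite ?NegzE ?mulrNz ?fN -!pmulrn fMn.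
Qed.

Let psi0 : psi 0 = 0.
Proof. by have := psiQ.1 0 0; rewrite !mulr0z. Qed.

Let psiMz x a : psi (x *~ a) = psi x *~ (a ^+ 2). Proof. exact: psiQ.1. Qed.

Let polarMz x y a c : polar psi (x *~ a) (y *~ c) = polar psi x y *~ (a * c).
Proof. by rewrite (morphMz x a (polarDl _)) (morphMz y c (polarDr _)) mulrC mulrzA. Qed.

Lemma psi_sum k (u : 'I_k -> T) : psi (\sum_j u j) =
  \sum_j psi (u j) + \sum_(j < k) \sum_(l < k | (j < l)%N) polar psi (u j) (u l).
Proof.
elim: k u => [|k IH] u; first by rewrite !big_ord0 psi0 addr0.
have -> : \sum_(j < k.+1) \sum_(l < k.+1 | (j < l)%N) polar psi (u j) (u l) =
  \sum_(j < k) \sum_(l < k | (j < l)%N) polar psi (u (widen_ord (leqnSn k) j)) (u (widen_ord (leqnSn k) l)) +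
  polar psi (\sum_(j < k) u (widen_ord (leqnSn k) j)) (u ord_max).
  rewrite big_ord_recr /= [X in _ + X]big1 ?addr0; last by move=> l /=; rewrite ltnNge -ltnS ltn_ord.
  rewrite (big_morph _ (polarDl (u ord_max)) (_ : _ = 0)); last first.
    by apply: (addrI (polar psi 0 (u ord_max))); rewrite -polarDl !addr0.
  rewrite -big_split; apply: eq_bigr => j _ /=.
  by rewrite big_mkcond big_ord_recr /= ltn_ord -big_mkcond.
rewrite !big_ord_recr /=; set S := \sum_(j < k) u _.
have -> : psi (S + u ord_max) = psi S + psi (u ord_max) + polar psi S (u ord_max).
  by rewrite /polar -[_ - _ - _]addrA -opprD [RHS]addrC subrK.
by rewrite {1}/S IH -!addrA; congr (_ + _); rewrite addrCA.
Qed.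

Let card_mul (t : T) : t *+ m = 0.
Proof.
apply: (addrI (\sum_(s : T) s)); rewrite addr0 -sumr_const -big_split /=.
by rewrite [RHS](reindex_inj (addIr t)).
Qed.

Let t_ (j : 'I_m) : T := enum_val j.
(** With m = #|T|, values of [polar psi] are killed by m and values of psi by m^2. Off-diagonal
    entries occur twice in the form, so they are numerators over K = N / 2. *)
Let K := (3 * m ^ 2)%N.
Let N := (2 * K)%N.

Let m0 : (0 < m)%N. Proof. by apply/card_gt0P; exists 0. Qed.
Let K0 : (0 < K)%N. Proof. by rewrite muln_gt0 expn_gt0 m0. Qed.
Let N1 : (1 < N)%N. Proof. by rewrite /N; lia. Qed.

(** The floor is exact whenever M kills q. *)
Let numer (M : nat) (q : QZ) : int := Num.floor (repr q * M%:R).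

Let expQZ_numer M q : (0 < M)%N -> q *+ M = 0 -> expQZ R q = E ((numer M q)%:~R / M%:R).
Proof.
move=> M0 qM; have /E_eq1 : E (repr q * M%:R) = 1.
  by rewrite mulr_natr EX -expQZ_repr -expQZMn qM expQZ0.
rewrite intrEfloor => /eqP e; rewrite /numer e mulfK ?expQZ_repr //.
by rewrite pnatr_eq0 -lt0n.
Qed.

(* A Gram matrix modulo N of the pull-back of psi to the free module on the elements of T. *)
Let C : 'M[int]_m := \matrix_(i, j)
  if i == j then numer N (psi (t_ i)) else numer K (polar psi (t_ i) (t_ j)).

Let CT : C^T = C.
Proof.
by apply/matrixP => i j; rewrite !mxE eq_sym; case: eqP => [->|_] //; rewrite polarC.
Qed.

Let E_diag i : E ((C i i)%:~R / N%:R) = expQZ R (psi (t_ i)).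
Proof.
rewrite mxE eqxx -expQZ_numer // ?(ltnW N1) //.
have e : psi (t_ i) *~ (m%:Z ^+ 2) = 0 by rewrite -psiMz -pmulrn card_mul.
rewrite /N /K pmulrn; have -> : (2 * (3 * m ^ 2))%N%:Z = m%:Z ^+ 2 * 6.
  by rewrite !PoszM; ring.
by rewrite mulrzA e mul0rz.
Qed.

Let E_offdiag i j : i != j -> E ((C i j)%:~R / K%:R) = expQZ R (polar psi (t_ i) (t_ j)).
Proof.
move=> ij; rewrite mxE (negPf ij) -expQZ_numer //.
have e : polar psi (t_ i) (t_ j) *~ (m%:Z * 1) = 0.
  rewrite -polarMz -pmulrn card_mul.
  by apply: (addrI (polar psi 0 (t_ j *~ 1))); rewrite -polarDl !addr0.
rewrite /K pmulrn; have -> : (3 * m ^ 2)%N%:Z = (m%:Z * 1) * (3 * m%:Z).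
  by rewrite !PoszM; ring.
by rewrite mulrzA e mul0rz.
Qed.

Let comb (x : 'rV[int]_m) : T := \sum_j t_ j *~ x 0 j.

Let combD : {morph comb : x y / x + y}.
Proof.
by move=> x y; rewrite /comb -big_split; apply: eq_bigr => j _; rewrite mxE mulrzDr.
Qed.

Let comb_scale x : comb (N%:Z *: x) = 0.
Proof.
rewrite /comb big1 // => j _; rewrite mxE mulrzA -pmulrn /N /K.
have -> : (2 * (3 * m ^ 2) = m * (6 * m))%N by lia.
by rewrite mulrnA card_mul mul0rn mul0rz.
Qed.

Let comb_surj t : exists x, t = comb x.
Proof.
exists (\row_j (enum_rank t == j)%:Z); rewrite /comb (bigD1 (enum_rank t)) //= mxE eqxx.
rewrite mulr1z /t_ enum_rankK big1 ?addr0 // => j /negPf tj.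
by rewrite mxE eq_sym tj mulr0z.
Qed.

Let E_int_mul (a : int) (q : rat) b : E q = expQZ R b -> E (a%:~R * q) = expQZ R (b *~ a).
Proof.
move=> e; rewrite expQZMz -e; case: a => k.
  by rewrite -[_ ^ _]/(_ ^+ k) -EX -mulr_natl.
by rewrite -[_ ^ _]/((_ ^+ k.+1)^-1) -EX -ENV NegzE rmorphN mulNr -mulr_natl.
Qed.

Let E_form x : E ((qform 1%:M C x)%:~R / N%:R) = expQZ R (psi (comb x)).
Proof.
have -> : qform 1%:M C x = \sum_i \sum_j x 0 i * C i j * x 0 j.
  rewrite /qform mul1mx /mxtrace big_ord1 mxE exchange_big; apply: eq_bigr => j _.
  by rewrite !mxE mulr_suml.
rewrite sum_symmetric => [|i j]; last by rewrite (symmetricE j i CT); ring.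
rewrite psi_sum expQZD rmorphD mulrDl ED; congr (_ * _).
  rewrite rmorph_sum mulr_suml E_sum (big_morph (expQZ R) (@expQZD R) (expQZ0 R)).
  apply: eq_bigr => i _; rewrite psiMz -(E_int_mul _ (E_diag i)); congr E.
  by rewrite expr2 !rmorphM /=; ring.
have NK : N%:R = 2 * K%:R :> rat by rewrite natrM.
have K0' : K%:R != 0 :> rat by rewrite pnatr_eq0 -lt0n.
set S := (X in X *+ 2); have -> : (S *+ 2)%:~R / N%:R = S%:~R / K%:R :> rat.
  by rewrite rmorphMn /= NK; field.
rewrite /S rmorph_sum mulr_suml E_sum (big_morph (expQZ R) (@expQZD R) (expQZ0 R)).
apply: eq_bigr => i _.
rewrite rmorph_sum mulr_suml E_sum (big_morph (expQZ R) (@expQZD R) (expQZ0 R)).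
apply: eq_bigr => j ij; have nij : i != j by apply/eqP => e; rewrite e ltnn in ij.
rewrite polarMz -(E_int_mul _ (E_offdiag nij)); congr E.
by rewrite !rmorphM /=; ring.
Qed.

Let pair (x y : 'rV[int]_m) : int := \tr (x *m C *m y^T).

Let pairC x y : pair x y = pair y x.
Proof. by rewrite /pair -[LHS]mxtrace_tr !trmx_mul trmxK CT mulmxA. Qed.

Let E_pair x y : E ((2 * pair x y)%:~R / N%:R) = expQZ R (polar psi (comb x) (comb y)).
Proof.
rewrite /polar !expQZD !expQZN -combD -!E_form -!ENV -!ED; congr E.
rewrite -!mulNr -!mulrDl; congr (_ / _); rewrite -!rmorphN -!rmorphD; congr (_%:~R).
rewrite /qform linearD /= !mul1mx !(mulmxDl, mulmxDr) !linearD /= -!/(pair _ _) (pairC y x).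
ring.
Qed.

(** As [comb] is onto, a vector in the radical of C maps into the radical of psi. *)
Let tameC : tame_mod N C.
Proof.
move=> x y e.
have : psi (comb x) = 0.
  apply: psiT => s; have [z ->] := comb_surj s; apply: (@expQZ_inj R).
  rewrite expQZ0 -E_pair E_int //.
  have -> : 2 * pair x z = N%:Z * \tr (y *m z^T).
    by rewrite /pair -!mxtraceZ scalemxAl e -scalemxAl.
  by rewrite rmorphM /= mulrC mulKf ?intr_int // pnatr_eq0 -lt0n ltnW.
move=> px; have := E_form x; rewrite px expQZ0 => /E_eq1 /intrP[z /(congr1 ( *%R^~ N%:R))] /eqP.
rewrite divfK ?pnatr_eq0 -?lt0n ?(ltnW N1) // -[N%:R]/(N%:Z%:~R) -rmorphM eqr_int => /eqP ->.
exact: dvdz_mull.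
Qed.

Let comb_mred n (X : 'M['Z_N]_(n, m)) Y i : X = mred N Y ->
  comb (row i (mlift X)) = comb (row i Y).
Proof.
by move=> ->; have [Z ->] := mredK N1 Y; rewrite linearD linearZ /= combD comb_scale addr0.
Qed.

(** W is a copy of T^n presented by [phi]: row vectors over T for the tensor product, and T itself
    with n = 1 for psi. *)
Lemma push_gauss n (B : 'M[int]_n) (W : finZmodType) (f : W -> QZ) (phi : ('I_n -> T) -> W) :
  (forall u v, phi (fun i => u i + v i) = phi u + phi v) ->
  (forall w, exists u, w = phi u) ->
  (forall u v, u =1 v -> phi u = phi v) ->
  (forall u, f (phi u) = \sum_(i < n) psi (u i) *~ B i i +
     \sum_(i < n) \sum_(j < n | (i < j)%N) polar psi (u i) (u j) *~ B i j) ->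
  B^T = B -> ray (qsum R N B C) (gauss_sum R f).
Proof.
move=> phiD phi_surj phi_ext phif BT.
pose Phi (X : 'M['Z_N]_(n, m)) := phi (fun i => comb (row i (mlift X))).
have PhiD : {morph Phi : X Y / X + Y}.
  move=> X Y; rewrite /Phi -phiD; apply: phi_ext => i.
  by rewrite (@comb_mred _ _ (mlift X + mlift Y)) ?mredD ?mliftK // linearD combD.
have Phi_surj w : exists X, w = Phi X.
  have [u ->] := phi_surj w.
  pose Y : 'M[int]_(n, m) := \matrix_i xget 0 [set x | u i = comb x]%classic.
  exists (mred N Y); apply: phi_ext => i; rewrite (@comb_mred _ _ Y) // rowK.
  exact: (xgetPex _ (comb_surj (u i))).
apply: ray_trans (ray_push_surj (fun w => expQZ R (f w)) PhiD Phi_surj).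
apply/ray_eq/eq_bigr => X _; rewrite /Phi phif; move: (mlift X) => V.
have -> : qchar R N B C V = E ((\sum_i \sum_j B i j * pair (row i V) (row j V))%:~R / N%:R).
  congr (E (_%:~R / _)).
  have -> : qform B C V = \tr (B *m (V *m C *m V^T)) by rewrite /qform !mulmxA.
  rewrite /mxtrace; apply: eq_bigr => i _; rewrite mxE; apply: eq_bigr => j _.
  congr (_ * _); rewrite pairC /pair /mxtrace big_ord1 -row_mul [LHS]mxE [RHS]mxE.
  by apply: eq_bigr => k _; congr (_ * _); rewrite !mxE.
rewrite sum_symmetric => [|i j]; last by rewrite (symmetricE j i BT) pairC.
rewrite expQZD rmorphD mulrDl ED; congr (_ * _).
  rewrite rmorph_sum mulr_suml E_sum (big_morph (expQZ R) (@expQZD R) (expQZ0 R)).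
  apply: eq_bigr => i _; rewrite -(E_int_mul _ (E_form _)); congr E.
  by rewrite rmorphM /= -mulrA /qform mul1mx.
set S := (X in X *+ 2); have -> : S *+ 2 = 2 * S by rewrite mulr_natl.
rewrite /S mulr_sumr rmorph_sum mulr_suml E_sum (big_morph (expQZ R) (@expQZD R) (expQZ0 R)).
apply: eq_bigr => i _.
rewrite mulr_sumr rmorph_sum mulr_suml E_sum (big_morph (expQZ R) (@expQZD R) (expQZ0 R)).
apply: eq_bigr => j _.
by rewrite -(E_int_mul _ (E_pair _ _)); congr E; rewrite mulrCA rmorphM /= mulrA.
Qed.

Lemma phase_ray (W : finZmodType) (f : W -> QZ) b :
  ray (gauss_sum R f) (expQZ R b) -> phase R f = b.
Proof.
move=> fb; have G0 : gauss_sum R f != 0 := ray_neq0 fb (expQZ_neq0 R b).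
have normb x : `|expQZ R x| = 1 by rewrite expQZ_repr normE.
have Gb := ray_norm (normb b) fb.
rewrite /phase; set S := [set x | _]%classic.
have [_ Gx] : S (xget 0 S) by apply: xgetPex; exists b.
apply: (@expQZ_inj R); apply: (@mulfI _ `|gauss_sum R f|); first by rewrite normr_eq0.
by rewrite -Gb -Gx.
Qed.

Lemma phase_forms : exists b, phase R psi = b /\
  forall n (B : 'M[int]_n), B^T = B -> \det B = 1 \/ \det B = -1 ->
  forall (W : finZmodType) (f : W -> QZ) (phi : ('I_n -> T) -> W),
  (forall u v, phi (fun i => u i + v i) = phi u + phi v) ->
  (forall w, exists u, w = phi u) ->
  (forall u v, u =1 v -> phi u = phi v) ->
  (forall u, f (phi u) = \sum_(i < n) psi (u i) *~ B i i +
     \sum_(i < n) \sum_(j < n | (i < j)%N) polar psi (u i) (u j) *~ B i j) ->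
  phase R f = b *~ signature (map_mx intr B : 'M[R]_n).
Proof.
have [b hb] := phase_mod_exists R N1 CT tameC; exists b; split; last first.
  move=> n B BT detB W f phi phiD phi_surj phi_ext phif; apply: phase_ray.
  exact: ray_trans (ray_sym (push_gauss phiD phi_surj phi_ext phif BT)) (hb n B BT detB).
(* The form of rank one with matrix 1 has signature 1, and its tensor product with psi is psi: this
   identifies b. *)
have := hb 1%N 1%:M (tr_scalar_mx _ _) (or_introl (det1 _ _)).
have -> : signature (map_mx intr (1%:M : 'M[int]_1) : 'M[R]_1) = 1.
  rewrite (@signature_diag R _ _ 1%:M (const_mx 1)) ?det1 //.
    by rewrite big_ord1 mxE.
  by rewrite mul1mx trmx1 mulmx1 diag_const_mx.
rewrite mulr1z => h1; apply: phase_ray; apply: ray_trans (ray_sym _) h1.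
apply: (@push_gauss 1 1%:M T psi (fun u => u ord0)) => //.
- by move=> w; exists (fun=> w).
- by move=> u; rewrite !big_ord1 big_mkcond big_ord1 /= mxE mulr1z addr0.
exact: tr_scalar_mx.
Qed.

End FiniteQuadraticFunction.

Theorem theorem2p4 (R : realType)
    (V : lmodType int) (n : nat) (e : 'I_n -> V) (B : {biscalar V})
    (T : finZmodType) (psi : T -> QZ) :
  is_basis e ->
  (forall v w : V, B v w = B w v) ->
  \det (gram e B) = 1 \/ \det (gram e B) = -1 ->
  quadratic psi ->
  tame psi ->
  phase R (form_tensor e B psi) =
    phase R psi *~ signature (map_mx intr (gram e B) : 'M[R]_n).
Proof.
move=> _ BC detB psiQ psiT.
have BT : (gram e B)^T = gram e B by apply/matrixP => i j; rewrite !mxE BC.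
have [b [-> forms]] := phase_forms R psiQ psiT.
apply: (forms n (gram e B) BT detB _ _ (fun u => \row_i u i)).
- by move=> u v; apply/rowP => i; rewrite !mxE.
- by move=> w; exists (fun i => w 0 i); apply/rowP => i; rewrite mxE.
- by move=> u v uv; apply/rowP => i; rewrite !mxE uv.
move=> u; congr (_ + _); apply: eq_bigr => i _; first by rewrite !mxE.
by apply: eq_bigr => j _; rewrite !mxE.
Qed.
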